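(* Let $b \geq 2$ be a fixed integer. Then there exists an effectively computable constant $a_0 = a_0(b)$, dependent only on $b$, such that for every integer $a > b$ with $a \geq a_0$ the simultaneous Pell equations \[ x^2 - a\, y^2 = 1, \qquad z^2 - b\, x^2 = 1 \] have at most one solution $(x,y,z)$ in positive integers.
   Context: ''Effectively computable, dependent only on $b$'' means that a value of $a_0(b)$ can be computed from $b$ by an explicit procedure. *)

(* Defs.v *)
From mathcomp Require Import all_boot all_order all_algebra.

Set Implicit Arguments.
Unset Strict Implicit.
Unset Printing Implicit Defensive.

Import GRing.Theory Num.Theory.
Local Open Scope ring_scope.

(* Programs for the n-ary partial (mu-)recursive functions on nat. *)
Inductive murec : nat -> Type :=
| MuZero n : murec n
| MuSucc : murec 1
| MuProj n (i : 'I_n) : murec n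
| MuComp m n (f : murec m) (g : 'I_m -> murec n) : murec n
| MuPrec n (f : murec n) (g : murec n.+2) : murec n.+1
| MuMin n (f : murec n.+1) : murec n.

(* [murec_eval c v r]: the program [c] halts on input [v] with result [r].
   - In [MuPrec f g] the recursion variable is the first argument, [s] lists the
     successive values, and [g] receives the step, the previous value, and then
     the parameters.
   - [MuMin f] searches for the least r with f (r, v) = 0 and diverges if f is
     undefined at some smaller argument. *)
Fixpoint murec_eval n (c : murec n) : n.-tuple nat -> nat -> Prop :=
  match c in murec n return n.-tuple nat -> nat -> Prop with
  | MuZero _ => fun _ r => r = 0%N
  | MuSucc => fun v r => r = (thead v).+1
  | MuProj _ i => fun v r => r = tnth v i
  | MuComp m _ f g => fun v r =>
      exists w : m.-tuple nat,
        (forall i, murec_eval (g i) v (tnth w i)) /\ murec_eval f w r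
  | MuPrec _ f g => fun v r =>
      let u := [tuple of behead v] in
      exists s : nat -> nat,
        [/\ murec_eval f u (s 0%N),
            forall k, (k < thead v)%N ->
              murec_eval g [tuple of k :: s k :: u] (s k.+1)
          & r = s (thead v)]
  | MuMin _ f => fun v r =>
      murec_eval f [tuple of r :: v] 0%N /\
      (forall k, (k < r)%N -> exists j, murec_eval f [tuple of k :: v] j.+1)
  end.

Definition computable (f : nat -> nat) : Prop :=
  exists c : murec 1, forall n, murec_eval c [tuple n] (f n).

Definition pell_solution (a b x y z : int) : Prop :=
  [/\ 0 < x, 0 < y & 0 < z] /\
  (x ^+ 2 - a * y ^+ 2 = 1 /\ z ^+ 2 - b * x ^+ 2 = 1).

(* Main.v *)
Require Import Defs.
From mathcomp Require Import all_boot all_order all_algebra.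
From mathcomp Require Import realalg.
From mathcomp Require Import zify ring lra.

Set Implicit Arguments.
Unset Strict Implicit.
Unset Printing Implicit Defensive.

Import Order.TTheory GRing.Theory Num.Theory.
Local Open Scope ring_scope.

(** Let (x1, y1, z1) and (x2, y2, z2) solve the system for the same a, with
    x1 < x2. Two estimates, pulling in opposite directions, exclude this as
    soon as a exceeds a fixed power of b.

    The second solution is not much larger than the first: z2 < z1 ^ 36
    ([pell_gap]). Put N = z1 ^ 2. The integers
      v = (z1 z2, b x1 x2, a b y1 y2)
    satisfy v_j ^ 2 = (N + a_j) (z2 ^ 2 - d_j) with a = (0, -1, -(b + 1)) and
    d = (0, 1, b + 1), hence they are nearly proportional to the three numbers
    sqrt (N + a_j), whose squares differ by little compared with N. Simultaneous
    rational approximations to such numbers are limited by the following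
    variant of the method of Siegel, Rickert and Bennett. Let g be the Hermite
    interpolant, of degree at most 3k + 2, of the three germs
      v_j (N + a_j) ^ (-1/2) (N + z) ^ (k + 1/2)   at z = a_j,
    taken to order k + 1, the whole being multiplied by a constant of size C ^ k
    that makes g an integer polynomial. One of the three leading
    coefficients of g is nonzero: otherwise (N + z) g' - (k + 1/2) g has degree
    less than 3k and vanishes to order k at the three nodes, so it is 0; as
    k + 1/2 is not an integer, this forces g = 0 and then v = 0
    ([hermite_jet_eq0]). That coefficient is therefore at least 1 in absolute
    value. But the Taylor polynomial of degree less than 3k of the same function
    at 0 is its own interpolant and has no such coefficients, and its germs
    differ from those of g by little, so the coefficient is at most
      C ^ k (z1 ^ (2k + 1) / z2 + z1 ^ 3 z2 / z1 ^ (4k))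
    ([pade_inequality]). If z2 is between z1 ^ (3k) and z1 ^ (3k + 3) with k at
    least 12, this is less than 1 once z1 is larger than a power of C. The
    function (N + z) ^ (k + 1/2) enters only through its binomial coefficients
    and its differential equation, so this part of the argument takes place in
    the field of rational numbers.

    On the other hand, both x1 + y1 sqrt a and x2 + y2 sqrt a are powers,
    with exponents m1 < m2, of one solution alpha of x ^ 2 - a y ^ 2 = 1
    ([pell_common_root]), and z_i + x_i sqrt b is extremely close to
    sqrt b (x_i + y_i sqrt a). Eliminating alpha, the unit
      (z1 + x1 sqrt b) ^ (2 m2) / (z2 + x2 sqrt b) ^ (2 m1)
    of Z[sqrt b] is b ^ (m2 - m1) up to a relative error of order
    m2 / x1 ^ 2. A unit of norm 1 cannot be that close to a power of b, by an
    argument in the style of Liouville ([unit_vs_power]), so x1 ^ 2 is at most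
    8 m2 b ^ (2 (m2 - m1)) ([pell_power_separation]). The gap bound gives
    m2 <= 37 m1, while 4 x1 ^ 2 >= alpha ^ (2 m1) >= a ^ m1. Hence a is bounded
    by a power of b, and a0 b = (b + 3) ^ 200 is large enough. *)

(** * Computability of powers *)

Definition mu_add : murec 2 :=
  MuPrec (MuProj (@ord0 0)) (MuComp MuSucc (fun=> MuProj (inord 1 : 'I_3))).

Definition mu_mul : murec 2 :=
  MuPrec (MuZero 1)
    (MuComp mu_add (fun i : 'I_2 => MuProj (inord i.+1 : 'I_3))).

Lemma mu_addP v : murec_eval mu_add v (thead v + thead [tuple of behead v])%N.
Proof.
exists (fun k => k + thead [tuple of behead v])%N; split=> // k _ /=.
exists [tuple (k + thead [tuple of behead v])%N]; split=> [i|] /=.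
  rewrite ord1 (tnth_nth 0%N) /= [RHS](tnth_nth 0%N) /= inordK //.
by rewrite theadE addSn.
Qed.

Lemma mu_mulP v : murec_eval mu_mul v (thead v * thead [tuple of behead v])%N.
Proof.
set y := thead [tuple of behead v].
exists (fun k => k * y)%N; split=> // k _.
exists [tuple (k * y)%N; y]; split=> [i|].
  case: i => [[|[|//]] lti] /=; rewrite !(tnth_nth 0%N) /= inordK //.
  by rewrite /y /thead (tnth_nth 0%N).
have := mu_addP [tuple (k * y)%N; y].
by rewrite theadE /thead (tnth_nth 0%N) /= mulSn addnC.
Qed.

Lemma computable_mul f g :
  computable f -> computable g -> computable (fun n => f n * g n)%N.
Proof.
move=> [c cP] [d dP].
exists (MuComp mu_mul (fun i : 'I_2 => if i == ord0 then c else d)) => n.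
exists [tuple f n; g n]; split=> [i|].
  by case: i => [[|[|//]] lti]; rewrite (tnth_nth 0%N) /=; [apply: cP|apply: dP].
by have := mu_mulP [tuple f n; g n]; rewrite theadE /thead (tnth_nth 0%N).
Qed.

Lemma computable_succ f : computable f -> computable (fun n => (f n).+1).
Proof.
move=> [c cP]; exists (MuComp MuSucc (fun=> c)) => n.
by exists [tuple f n]; split=> [i|]; rewrite ?theadE // (tnth_nth 0%N) ord1.
Qed.

Lemma computable_id : computable id.
Proof. by exists (MuProj ord0) => n. Qed.

Lemma computable_one : computable (fun=> 1%N).
Proof. by apply: computable_succ; exists (MuZero 1). Qed.

Lemma computable_exp f e : computable f -> computable (fun n => f n ^ e)%N.
Proof.
move=> cf; elim: e => [|e IHe]; first exact: computable_one.
have [c cP] := computable_mul cf IHe.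
by exists c => n; rewrite expnS; apply: cP.
Qed.

(** * The sum of the absolute values of the coefficients of a polynomial *)

Definition l1 (p : {poly rat}) : rat := \sum_(i < size p) `|p`_i|.

Lemma l1_wide n (p : {poly rat}) : (size p <= n)%N -> l1 p = \sum_(i < n) `|p`_i|.
Proof.
move=> len; rewrite /l1 (big_ord_widen n (fun i => `|p`_i|) len) big_mkcond.
by apply: eq_bigr => i _; case: ltnP => // /(nth_default 0) ->; rewrite normr0.
Qed.

Lemma l1_ge0 p : 0 <= l1 p.
Proof. exact: sumr_ge0. Qed.

Lemma l1_0 : l1 0 = 0.
Proof. by rewrite /l1 size_poly0 big_ord0. Qed.

Lemma l1C c : l1 c%:P = `|c|.
Proof. by rewrite (@l1_wide 1) ?size_polyC_leq1 // big_ord1 coefC. Qed.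

Lemma l1D (p q : {poly rat}) : l1 (p + q) <= l1 p + l1 q.
Proof.
pose n := maxn (size p) (size q).
rewrite (@l1_wide n (p + q)) ?size_polyD // (@l1_wide n p) ?leq_maxl //.
rewrite (@l1_wide n q) ?leq_maxr // -big_split /=.
by apply: ler_sum => i _; rewrite coefD ler_normD.
Qed.

Lemma l1N (p : {poly rat}) : l1 (- p) = l1 p.
Proof. by rewrite /l1 size_polyN; apply: eq_bigr => i _; rewrite coefN normrN. Qed.

Lemma l1_sum I (r : seq I) P (F : I -> {poly rat}) :
  l1 (\sum_(i <- r | P i) F i) <= \sum_(i <- r | P i) l1 (F i).
Proof.
elim/big_ind2: _ => [|p x q y le1 le2|//]; first by rewrite l1_0.
by apply: le_trans (l1D _ _) _; apply: lerD.
Qed.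

Lemma l1Z c p : l1 (c *: p) = `|c| * l1 p.
Proof.
rewrite (@l1_wide (size p)) ?size_scale_leq // mulr_sumr.
by apply: eq_bigr => i _; rewrite coefZ normrM.
Qed.

Lemma l1_mulXn p n : l1 (p * 'X^n) = l1 p.
Proof.
rewrite (@l1_wide (n + size p)); last first.
  by rewrite (leq_trans (size_polyMleq _ _)) // size_polyXn addnS /= addnC.
rewrite big_split_ord /= big1 ?add0r => [|i _].
  by apply: eq_bigr => i _; rewrite coefMXn ltnNge leq_addr /= addKn.
by rewrite coefMXn ltn_ord normr0.
Qed.

(** Submultiplicativity is what makes this norm convenient: all size estimates
    for the interpolant reduce to estimates for its factors. *)
Lemma l1M p q : l1 (p * q) <= l1 p * l1 q.
Proof.
rewrite -{1}[p]coefK poly_def mulr_suml (le_trans (l1_sum _ _ _)) // mulr_suml.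
by apply: ler_sum => i _; rewrite -scalerAl l1Z mulrC [_ * q]mulrC l1_mulXn mulrC.
Qed.

Lemma l1_exp p n : l1 (p ^+ n) <= l1 p ^+ n.
Proof.
elim: n => [|n IHn]; first by rewrite !expr0 l1C normr1.
by rewrite !exprS (le_trans (l1M _ _)) // ler_wpM2l // l1_ge0.
Qed.

Lemma l1_prod (I : Type) (r : seq I) P (F : I -> {poly rat}) :
  l1 (\prod_(i <- r | P i) F i) <= \prod_(i <- r | P i) l1 (F i).
Proof.
suff: 0 <= l1 (\prod_(i <- r | P i) F i) <= \prod_(i <- r | P i) l1 (F i).
  by case/andP.
elim/big_ind2: _ => [|p x q y /andP[p0 px] /andP[q0 qy]|i _].
- by rewrite l1C normr1 lexx ler01.
- by rewrite l1_ge0 (le_trans (l1M _ _)) ?ler_pM.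
- by rewrite l1_ge0 lexx.
Qed.

Lemma l1X : l1 'X = 1.
Proof. by rewrite -(mul1r 'X) -(expr1 'X) l1_mulXn l1C normr1. Qed.

Lemma l1_XaddC c : l1 ('X + c%:P) <= 1 + `|c|.
Proof. by rewrite (le_trans (l1D _ _)) // l1X l1C. Qed.

Lemma l1_XsubC c : l1 ('X - c%:P) <= 1 + `|c|.
Proof. by rewrite -polyCN -(normrN c) l1_XaddC. Qed.

Lemma l1_take n p : l1 (take_poly n p) <= l1 p.
Proof.
rewrite (@l1_wide (maxn n (size p)) (take_poly n p)); last first.
  by rewrite (leq_trans (size_take_poly _ _)) ?leq_maxl.
rewrite (@l1_wide (maxn n (size p)) p) ?leq_maxr //.
by apply: ler_sum => i _; rewrite coef_take_poly; case: ifP; rewrite ?normr0.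
Qed.

Lemma coef_le_l1 (p : {poly rat}) i : `|p`_i| <= l1 p.
Proof.
have [lti|] := ltnP i (size p); last first.
  by move/(nth_default 0) ->; rewrite normr0 l1_ge0.
by rewrite /l1 (bigD1 (Ordinal lti)) //= lerDl sumr_ge0.
Qed.

Lemma l1_comp n (p q : {poly rat}) : (size p <= n.+1)%N -> 1 <= l1 q ->
  l1 (p \Po q) <= l1 p * l1 q ^+ n.
Proof.
move=> sp q1; rewrite comp_polyE (le_trans (l1_sum _ _ _)) // mulr_suml.
apply: ler_sum => i _; rewrite l1Z ler_wpM2l // (le_trans (l1_exp _ _)) //.
by rewrite ler_weXn2l // -ltnS (leq_trans (ltn_ord i)).
Qed.

Lemma horner_le_l1 (p : {poly rat}) y : `|y| <= 1 -> `|p.[y]| <= l1 p.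
Proof.
move=> y1; rewrite horner_coef (le_trans (ler_norm_sum _ _ _)) //.
apply: ler_sum => i _; rewrite normrM normrX ler_piMr //.
exact: exprn_ile1.
Qed.

(** * Hermite interpolation with controlled denominators *)

Lemma dvdp_sum (I : Type) (r : seq I) (P : pred I) (F : I -> {poly rat}) d :
  (forall i, P i -> d %| F i) -> d %| \sum_(i <- r | P i) F i.
Proof.
by move=> dF; elim/big_ind: _ => [|x y|//]; [exact: dvdp0|exact: dvdp_add].
Qed.

(** A multiple of the inverse of (X + d) ^ (k+1) modulo X ^ (k+1). Expanding
    d ^ (2k+1) = ((X + d) - X) ^ (2k+1), every term contains X ^ (k+1) or
    (X + d) ^ (k+1); this polynomial collects the cofactors of the latter. It
    has integer coefficients of size exponential in k. *)
Definition bezout_inv (k : nat) (d : rat) : {poly rat} :=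
  \sum_(i < k.+1) ('X + d%:P) ^+ (k - i) * (- 'X) ^+ i *+ 'C(k.+1 + k, i).

Lemma bezout_invP k d :
  'X ^+ k.+1 %| ('X + d%:P) ^+ k.+1 * bezout_inv k d - (d ^+ (k.+1 + k))%:P.
Proof.
have E : (d ^+ (k.+1 + k))%:P
    = (('X + d%:P) + (- 'X)) ^+ (k.+1 + k) :> {poly rat}.
  by rewrite addrAC subrr add0r polyC_exp.
rewrite E (exprDn _ (- 'X)) -addnS big_split_ord /= [X in _ - (X + _)](_ : _ =
  ('X + d%:P) ^+ k.+1 * bezout_inv k d).
  rewrite opprD addrA subrr add0r dvdpNr; apply: dvdp_sum => i _.
  rewrite -mulrnAl dvdp_mull // exprNn dvdp_mull // dvdp_exp2l //.
  by rewrite leq_addr.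
rewrite mulr_sumr; apply: eq_bigr => i _; rewrite mulrnAr mulrA -exprD.
by congr (_ ^+ _ * _ *+ _); have := ltn_ord i; lia.
Qed.

Lemma bezout_inv_int k d : d \is a Num.int ->
  bezout_inv k d \is a polyOver Num.int_num_subdef.
Proof.
move=> dint; apply: rpred_sum => i _; apply: rpredMn; apply: rpredM.
  by rewrite rpredX // rpredD ?polyOverX ?polyOverC.
by rewrite rpredX // rpredN polyOverX.
Qed.

Lemma l1_bezout_inv k d : l1 (bezout_inv k d) <= (2 + `|d|) ^+ (k.+1 + k).
Proof.
have -> : 2 + `|d| = (1 + `|d|) + 1 by ring.
rewrite exprDn -addnS big_split_ord /= (le_trans (l1_sum _ _ _)) //.
rewrite -[leLHS]addr0 lerD //; last first.
  by apply: sumr_ge0 => i _; rewrite mulrn_wge0 // mulr_ge0 ?exprn_ge0 // addr_ge0.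
apply: ler_sum => i _; rewrite -scaler_nat l1Z normr_nat -[leRHS]mulr_natl.
rewrite ler_wpM2l // expr1n mulr1 (le_trans (l1M _ _)) //.
have h1 : l1 ((- 'X) ^+ i) <= 1.
  by rewrite (le_trans (l1_exp _ _)) // l1N l1X expr1n.
rewrite -[leRHS]mulr1 ler_pM ?l1_ge0 // (le_trans (l1_exp _ _)) //.
apply: (@le_trans _ _ ((1 + `|d|) ^+ (k - i))).
  by rewrite lerXn2r ?nnegrE ?l1_ge0 ?addr_ge0 // l1_XaddC.
by rewrite ler_weXn2l ?lerDl //; have := ltn_ord i; lia.
Qed.

Lemma dvdp_prod_coprime (I : eqType) (r : seq I) (F : I -> {poly rat}) p :
  uniq r -> {in r &, forall i j, i != j -> coprimep (F i) (F j)} ->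
  {in r, forall i, F i %| p} -> \prod_(i <- r) F i %| p.
Proof.
elim: r => [|i r IHr] /=; first by rewrite big_nil dvd1p.
move=> /andP[inr ur] cop dvd; rewrite big_cons Gauss_dvdp.
  rewrite dvd ?mem_head // IHr // => [j l jr lr|j jr].
    by apply: cop; rewrite inE ?jr ?lr orbT.
  by apply: dvd; rewrite inE jr orbT.
rewrite big_seq; elim/big_ind: _ => [|x y cx cy|j jr].
- exact: coprimep1.
- by rewrite coprimepMr cx cy.
- apply: cop; rewrite ?mem_head ?inE ?jr ?orbT //.
  by apply: contraNneq inr => ->.
Qed.

Lemma dvdp_prod_sub (I : Type) (r : seq I) (P : pred I)
    (F G : I -> {poly rat}) (d : {poly rat}) :
  (forall i, P i -> d %| F i - G i) ->
  d %| \prod_(i <- r | P i) F i - \prod_(i <- r | P i) G i.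
Proof.
move=> dFG; elim/big_ind2: _ => [|y x y' x' dx dx'|//]; first by rewrite subrr dvdp0.
rewrite (_ : _ - _ = (x - y) * x' + y * (x' - y')); last by ring.
by apply: dvdp_add; [apply: dvdp_mulr|apply: dvdp_mull].
Qed.

Lemma dvdp_comp_poly (p q r : {poly rat}) : p %| q -> p \Po r %| q \Po r.
Proof. by case/dvdpP => s ->; rewrite comp_polyM dvdp_mull. Qed.

Lemma size_prod_exp_XsubC (I : finType) (P : pred I) (a : I -> rat) m :
  size (\prod_(j | P j) ('X - (a j)%:P) ^+ m) = (m * #|P|).+1.
Proof.
rewrite size_prod => [|j _]; last by rewrite expf_neq0 ?polyXsubC_eq0.
under eq_bigr do rewrite size_exp_XsubC.
by rewrite sum_nat_const mulnS mulnC subSn ?leq_addr // addKn.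
Qed.

Section Hermite.

Variables (I : finType) (a : I -> rat) (k : nat).
Hypothesis a_inj : injective a.

(** The factors attached to distinct nodes are coprime, so their product, of
    degree m times the number of nodes, divides p. *)
Lemma hermite_unique m (p : {poly rat}) :
  (size p <= #|I| * m)%N -> (forall j, ('X - (a j)%:P) ^+ m %| p) -> p = 0.
Proof.
move=> sp dvd; apply/eqP; apply: contraTT sp => p0; rewrite -ltnNge.
have dv : \prod_(j <- index_enum I) ('X - (a j)%:P) ^+ m %| p.
  apply: dvdp_prod_coprime => [|i j _ _ ij|j _]; rewrite ?index_enum_uniq //.
  rewrite coprimep_expl // coprimep_expr // coprimep_XsubC root_XsubC.
  by apply: contra ij => /eqP/a_inj ->.
have := dvdp_leq p0 dv; apply: leq_trans.
by rewrite size_prod_exp_XsubC mulnC.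
Qed.

Definition cofac j : {poly rat} := \prod_(l | l != j) ('X - (a l)%:P) ^+ k.+1.

(** Inverse of [cofac j] near the node [a j], up to the factor [denom j], in the
    local coordinate X = z - a j. *)
Definition cofac_inv j : {poly rat} :=
  \prod_(l | l != j) bezout_inv k (a j - a l).

Definition denom j : rat := \prod_(l | l != j) (a j - a l) ^+ (k.+1 + k).

(** The interpolant of the germs [R j], given in the local coordinate z - a j,
    to order k + 1 at each node. The common factor [\prod_i denom i] clears all
    denominators; it is exponential in k when the nodes are fixed integers.
    Truncating in the local coordinate, rather than dividing by the product of
    all the factors, keeps the coefficients exponential in k as well. *)
Definition hermite (R : I -> {poly rat}) : {poly rat} :=
  \sum_j (\prod_(i | i != j) denom i) *:
    (cofac j * (take_poly k.+1 (cofac_inv j * R j) \Po ('X - (a j)%:P))).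

Lemma cofac_invP j :
  'X ^+ k.+1 %| (cofac j \Po ('X + (a j)%:P)) * cofac_inv j - (denom j)%:P.
Proof.
rewrite (rmorph_prod (comp_poly _)) -big_split /= (rmorph_prod polyC) /=.
apply: dvdp_prod_sub => l _.
rewrite rmorphXn /= comp_polyB comp_polyX comp_polyC -addrA -polyCB.
exact: bezout_invP.
Qed.

Lemma hermite_cong R j :
  ('X - (a j)%:P) ^+ k.+1 %|
    hermite R - (\prod_i denom i) *: (R j \Po ('X - (a j)%:P)).
Proof.
rewrite /hermite (bigD1 j) //= addrAC; apply: dvdp_add; last first.
  apply: dvdp_sum => i ij; rewrite -mul_polyC dvdp_mull // dvdp_mulr //.
  by rewrite /cofac (bigD1 j) ?dvdp_mulr // eq_sym.
have -> : \prod_i denom i = (\prod_(i | i != j) denom i) * denom j.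
  by rewrite (bigD1 j) //= mulrC.
rewrite -scalerA -scalerBr -mul_polyC dvdp_mull //.
set q := take_poly _ _; set Y := 'X - _.
have YK : ('X + (a j)%:P) \Po Y = 'X :> {poly rat}.
  by rewrite comp_polyD comp_polyX comp_polyC subrK.
have -> : cofac j * (q \Po Y) - denom j *: (R j \Po Y)
   = ((cofac j \Po ('X + (a j)%:P)) * q - denom j *: R j) \Po Y.
  by rewrite comp_polyB comp_polyM -comp_polyA YK comp_polyXr comp_polyZ.
have -> : Y ^+ k.+1 = 'X ^+ k.+1 \Po Y by rewrite rmorphXn /= comp_polyX.
apply: dvdp_comp_poly.
have /dvdpP[s Es] := cofac_invP j.
have := poly_take_drop k.+1 (cofac_inv j * R j); rewrite -/q.
set r := drop_poly _ _; move=> Eq.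
have {Eq} -> : q = cofac_inv j * R j - r * 'X ^+ k.+1 by rewrite -Eq addrK.
set c := cofac j \Po _ in Es *.
have -> : c * (cofac_inv j * R j - r * 'X ^+ k.+1) - denom j *: R j
  = (c * cofac_inv j - (denom j)%:P) * R j - c * r * 'X ^+ k.+1.
  by rewrite -mul_polyC; ring.
by rewrite Es mulrAC -mulrBl dvdp_mull.
Qed.

Lemma size_hermite R : (size (hermite R) <= #|I| * k.+1)%N.
Proof.
rewrite (leq_trans (size_sum _ _ _)) //; apply/bigmax_leqP => j _.
rewrite (leq_trans (size_scale_leq _ _)) //.
rewrite (leq_trans (size_polyMleq _ _)) // size_prod_exp_XsubC cardC1 addSn /=.
have s1 : (size (take_poly k.+1 (cofac_inv j * R j) \Po ('X - (a j)%:P))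
           <= k.+1)%N.
  by rewrite size_comp_poly2 ?size_XsubC // size_take_poly.
have : (0 < #|I|)%N by apply/card_gt0P; exists j.
by move: s1; case: #|I| => // n s1 _; rewrite [leqRHS]mulnC mulnSr leq_add2l.
Qed.

Lemma hermiteB R S :
  hermite R - hermite S = hermite (fun j => R j - S j).
Proof.
rewrite -sumrB; apply: eq_bigr => j _.
by rewrite -scalerBr -mulrBr -comp_polyB -raddfB -mulrBr.
Qed.

(** A polynomial of small degree is its own interpolant; applied to the Taylor
    polynomial, this isolates the leading coefficients of the interpolant as an
    error term. *)
Lemma hermite_id (p : {poly rat}) : (size p <= #|I| * k.+1)%N ->
  hermite (fun j => p \Po ('X + (a j)%:P)) = (\prod_i denom i) *: p.
Proof.
move=> sp; apply/eqP; rewrite -subr_eq0; apply/eqP.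
apply: (@hermite_unique k.+1) => [|j].
  rewrite (leq_trans (size_polyD _ _)) // geq_max size_hermite size_polyN.
  by rewrite (leq_trans (size_scale_leq _ _)).
have := hermite_cong (fun j => p \Po ('X + (a j)%:P)) j.
by rewrite -comp_polyA comp_polyD comp_polyX comp_polyC subrK comp_polyXr.
Qed.

Lemma take_poly_int n (p : {poly rat}) : p \is a polyOver Num.int_num_subdef ->
  take_poly n p \is a polyOver Num.int_num_subdef.
Proof.
move=> /polyOverP pint; apply/polyOverP => i.
by rewrite coef_take_poly; case: ifP => _; [apply: pint|apply: rpred0].
Qed.

Lemma comp_poly_int (p q : {poly rat}) :
  p \is a polyOver Num.int_num_subdef -> q \is a polyOver Num.int_num_subdef ->
  p \Po q \is a polyOver Num.int_num_subdef.
Proof.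
move=> /polyOverP pint qint; rewrite comp_polyE; apply: rpred_sum => i _.
by rewrite polyOverZ ?rpredX.
Qed.

Lemma hermite_int R : (forall j, a j \is a Num.int) ->
  (forall j, R j \is a polyOver Num.int_num_subdef) ->
  hermite R \is a polyOver Num.int_num_subdef.
Proof.
move=> aint Rint.
have Yint j : 'X - (a j)%:P \is a polyOver Num.int_num_subdef.
  by rewrite rpredB ?polyOverX ?polyOverC //; apply: aint.
apply: rpred_sum => j _; apply: polyOverZ.
  apply: rpred_prod => i _; apply: rpred_prod => l _.
  by apply: rpredX; apply: rpredB; apply: aint.
apply: rpredM; first by apply: rpred_prod => l _; apply: rpredX.
apply: comp_poly_int => //; apply/take_poly_int/rpredM => //.
by apply: rpred_prod => l _; apply: bezout_inv_int; rewrite rpredB.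
Qed.

Lemma hermite_take R : hermite R = hermite (fun j => take_poly k.+1 (R j)).
Proof.
apply: eq_bigr => j _; congr (_ *: (_ * (_ \Po _))).
rewrite -{1}(poly_take_drop k.+1 (R j)) mulrDr mulrA take_polyD.
by rewrite take_polyMXn_0 addr0.
Qed.

Lemma l1_hermite n B M R : #|I| = n.+1 -> 1 <= B ->
  (forall j, `|a j| <= B) -> (forall i j, `|a i - a j| <= B) ->
  (forall j, l1 (R j) <= M) ->
  l1 (hermite R) <=
    n.+1%:R * ((B + 2) ^+ (n * (n * (k.+1 + k) + (k.+1 + (k.+1 + k))) + k) * M).
Proof.
move=> cI B1 aB daB RM.
have B0 : 0 <= B := le_trans ler01 B1.
have C1 : 1 <= B + 2 by rewrite -[leLHS]add0r lerD.
have cpred (j : I) : #|[pred i | i != j]| = n.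
  have e : #|predC1 j| = n by rewrite cardC1 cI.
  by rewrite -[RHS]e; apply: eq_card.
have le_prod (F : I -> rat) (e : nat) j :
    (forall i, 0 <= F i <= (B + 2) ^+ e) ->
    \prod_(i | i != j) F i <= (B + 2) ^+ (n * e).
  move=> Fle; have -> : (B + 2) ^+ (n * e) = \prod_(i | i != j) (B + 2) ^+ e.
    by rewrite prodr_const cpred mulnC exprM.
  by apply: ler_prod => i _.
have denomle j : `|denom j| <= (B + 2) ^+ (n * (k.+1 + k)).
  rewrite normr_prod; apply: le_prod => i; rewrite normr_ge0 normrX /=.
  rewrite lerXn2r ?nnegrE ?normr_ge0 ?(le_trans ler01) //.
  by rewrite (le_trans (daB _ _)) // lerDl.
rewrite (le_trans (l1_sum _ _ _)) // -cI -sum1_card natr_sum mulr_suml.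
apply: ler_sum => j _; rewrite mul1r l1Z.
have h1 : `|\prod_(i | i != j) denom i| <= (B + 2) ^+ (n * (n * (k.+1 + k))).
  by rewrite normr_prod; apply: le_prod => i; rewrite normr_ge0 denomle.
have h2 : l1 (cofac j) <= (B + 2) ^+ (n * k.+1).
  rewrite (le_trans (l1_prod _ _ _)) //; apply: le_prod => i.
  rewrite l1_ge0 (le_trans (l1_exp _ _)) // lerXn2r ?nnegrE ?l1_ge0 //.
    exact: le_trans C1.
  by rewrite (le_trans (l1_XsubC _)) // addrC lerD.
have h3 : l1 (cofac_inv j) <= (B + 2) ^+ (n * (k.+1 + k)).
  rewrite (le_trans (l1_prod _ _ _)) //; apply: le_prod => i.
  rewrite l1_ge0 (le_trans (l1_bezout_inv _ _)) // lerXn2r ?nnegrE ?addr_ge0 //.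
  by rewrite addrC lerD2r.
have h4 p : l1 (take_poly k.+1 p \Po ('X - (a j)%:P)) <= (B + 2) ^+ k * l1 p.
  have lX : l1 ('X - (a j)%:P) = 1 + `|a j|.
    rewrite (@l1_wide 2) ?size_XsubC // big_ord_recl big_ord1 !coefB !coefX.
    by rewrite !coefC /= sub0r subr0 normrN normr1 addrC.
  rewrite (le_trans (l1_comp (size_take_poly _ _) _)) ?lX ?lerDl //.
  rewrite mulrC ler_pM ?l1_ge0 ?exprn_ge0 ?addr_ge0 ?l1_take //.
  rewrite lerXn2r ?nnegrE ?addr_ge0 // addrC lerD //.
have h5 := le_trans (h4 (cofac_inv j * R j)) (ler_wpM2l (exprn_ge0 k (le_trans ler01 C1)) (l1M _ _)).
rewrite (le_trans (ler_pM _ _ h1 (le_trans (l1M _ _) (ler_pM _ _ h2 h5)))) ?l1_ge0 ?mulr_ge0 ?l1_ge0 //.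
have M0 : 0 <= M := le_trans (l1_ge0 _) (RM j).
have -> : (n * (n * (k.+1 + k) + (k.+1 + (k.+1 + k))) + k)%N
    = (n * (n * (k.+1 + k)) + (n * k.+1 + (k + n * (k.+1 + k))))%N by lia.
rewrite (exprD _ (n * (n * (k.+1 + k)))) (exprD _ (n * k.+1)) (exprD _ k).
set e0 := _ ^+ (n * (n * _)); set e1 := _ ^+ (n * k.+1).
set e2 := _ ^+ (n * (k.+1 + k)); set e3 := _ ^+ k.
have e_ge0 e : 0 <= (B + 2) ^+ e by apply/exprn_ge0/(le_trans ler01).
rewrite -!mulrA !ler_wpM2l ?e_ge0 //.
by rewrite ler_pM ?l1_ge0.
Qed.

End Hermite.

(** * Binomial coefficients at half-integers *)

Definition gbin (x : rat) (h : nat) : rat :=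
  \prod_(i < h) ((x - i%:R) / i.+1%:R).

Lemma gbin0 x : gbin x 0 = 1.
Proof. by rewrite /gbin big_ord0. Qed.

Lemma gbinS x h : gbin x h.+1 = gbin x h * ((x - h%:R) / h.+1%:R).
Proof. by rewrite /gbin big_ord_recr. Qed.

Lemma gbinS_mul x h : h.+1%:R * gbin x h.+1 = (x - h%:R) * gbin x h.
Proof. by rewrite gbinS; field; rewrite addrC natr1 pnatr_eq0. Qed.

Lemma gbin_absorb x h : h.+1%:R * gbin (x + 1) h.+1 = (x + 1) * gbin x h.
Proof.
elim: h => [|h IHh]; first by rewrite gbinS !gbin0; field.
have h1 : h.+1%:R != 0 :> rat by rewrite pnatr_eq0.
rewrite gbinS_mul; apply: (mulfI h1); rewrite mulrCA IHh.
transitivity ((x + 1) * (h.+1%:R * gbin x h.+1)); last by ring.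
by rewrite gbinS_mul -natr1; ring.
Qed.

Lemma gbin_pascal x h : gbin (x + 1) h.+1 = gbin x h.+1 + gbin x h.
Proof.
have h1 : h.+1%:R != 0 :> rat by rewrite pnatr_eq0.
apply: (mulfI h1); rewrite gbin_absorb mulrDr gbinS_mul -natr1; ring.
Qed.

(** 4 ^ h binom(-1/2, h) is, up to sign, a central binomial coefficient; this is
    where the integrality of the binomial coefficients at half-integers, up to
    powers of 4, comes from. *)
Lemma gbin_half_central h :
  4 ^+ h * gbin (- 2^-1) h = (-1) ^+ h * 'C(h.*2, h)%:R.
Proof.
elim: h => [|h IHh]; first by rewrite gbin0 bin0 !expr0.
have h1 : h.+1%:R != 0 :> rat by rewrite pnatr_eq0.
apply: (mulfI h1).
have -> : h.+1%:R * (4 ^+ h.+1 * gbin (- 2^-1) h.+1)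
        = 4 * 4 ^+ h * (h.+1%:R * gbin (- 2^-1) h.+1) by rewrite exprS; ring.
rewrite gbinS_mul.
have -> : 4 * 4 ^+ h * ((- 2^-1 - h%:R) * gbin (- 2^-1) h)
   = - (2 * (h.*2.+1)%:R) * (4 ^+ h * gbin (- 2^-1) h).
  by rewrite -(natr1 h.*2) -mul2n natrM; field.
rewrite IHh exprS.
have E : (h.+1 * 'C(h.+1.*2, h.+1) = 2 * h.*2.+1 * 'C(h.*2, h))%N.
  have e1 : (h.+1 * 'C(h.*2.+2, h.+1) = h.*2.+2 * 'C(h.*2.+1, h))%N.
    by rewrite -mul_bin_diag.
  have e2 : (h.+1 * 'C(h.*2.+1, h) = h.*2.+1 * 'C(h.*2, h))%N.
    have := mul_bin_down h.*2.+1 h.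
    by rewrite (_ : h.*2.+1 - h = h.+1)%N //; rewrite -addnn; lia.
  rewrite doubleS e1 -(doubleS h) -mul2n.
  by rewrite -!mulnA; congr (_ * _)%N; rewrite e2.
have -> : h.+1%:R * (-1 * (-1) ^+ h * 'C(h.+1.*2, h.+1)%:R)
  = - (-1) ^+ h * (h.+1 * 'C(h.+1.*2, h.+1))%:R :> rat by rewrite natrM; ring.
by rewrite E !natrM; ring.
Qed.

Definition halfn (k : nat) : rat := k%:R - 2^-1.

Lemma halfnS k : halfn k.+1 = halfn k + 1.
Proof. by rewrite /halfn -natr1; ring. Qed.

(** Pascal's rule propagates integrality, and in [gbin_half_le] the bound, from
    -1/2 to all larger half-integers. *)
Lemma gbin_half_int k h : 4 ^+ h * gbin (halfn k) h \is a Num.int.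
Proof.
elim: k h => [|k IHk] [|h]; rewrite ?gbin0 ?mulr1 ?rpredX ?rpred_nat //.
  by rewrite /halfn sub0r gbin_half_central rpredM ?rpredX ?rpred_nat ?rpredN.
rewrite halfnS gbin_pascal mulrDr rpredD // exprS -mulrA.
by rewrite rpredM ?rpred_nat.
Qed.

Lemma gbin_half_le k h : `|gbin (halfn k) h| <= 2 ^+ k.
Proof.
elim: k h => [|k IHk] [|h]; rewrite ?gbin0 ?normr1 ?exprn_ege1 ?ler1n //.
  rewrite expr0; elim: h.+1 => {h} [|h IHh]; first by rewrite gbin0 normr1.
  rewrite gbinS normrM; apply: mulr_ile1; [exact: normr_ge0..|exact: IHh|].
  have h1 : 0 < h.+1%:R :> rat by rewrite ltr0n.
  rewrite normf_div (gtr0_norm h1) (ler_pdivrMr _ _ h1) mul1r -natr1.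
  have h0 : 0 <= h%:R :> rat by exact: ler0n.
  by rewrite /halfn ler_norml; apply/andP; split; lra.
rewrite halfnS gbin_pascal exprS mulr2n mulrDl mul1r.
by apply: le_trans (ler_normD _ _) _; apply: lerD.
Qed.

Lemma gbin_half_ge1 k h : (h < k)%N -> 1 <= gbin (halfn k) h.
Proof.
elim: h k => [|h IHh] [|k] //; first by rewrite gbin0.
rewrite ltnS => lthk; have := gbin_absorb (halfn k) h.
rewrite -halfnS => E.
have h1 : 0 < h.+1%:R :> rat by rewrite ltr0n.
rewrite -(ler_pM2l h1) E mulr1.
have le1 := IHh _ lthk.
have : h.+1%:R <= halfn k.+1.
  have : (h.+2 <= k.+1)%N by [].
  by rewrite -(ler_nat rat) /halfn -natr1 => ?; lra.
move=> le2; rewrite -[leLHS]mulr1; apply: ler_pM => //; exact: ler0n.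
Qed.

Lemma halfn_nat k m : halfn k != m%:R.
Proof.
apply/eqP => E; have : (k.*2)%:R = (m.*2.+1)%:R :> rat.
  by rewrite -natr1 -!muln2 !natrM -E /halfn; field.
by move/eqP; rewrite eqr_nat => /eqP /(congr1 odd); rewrite /= !odd_double.
Qed.

(** * Nonvanishing of the leading coefficients *)

Lemma dvdp_Xn_coef k (p : {poly rat}) :
  (forall i, (i < k)%N -> p`_i = 0) -> 'X^k %| p.
Proof.
move=> p0; rewrite -(poly_take_drop k p) (_ : take_poly k p = 0).
  by rewrite add0r dvdp_mull.
by apply/polyP => i; rewrite coef_take_poly coef0; case: ifP => // /p0.
Qed.

(** This vanishes on c (u + X) ^ x, and on a truncation of that function it
    measures the error made by truncating. *)
Definition ode_defect (x u : rat) (p : {poly rat}) : {poly rat} :=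
  ('X + u%:P) * p^`() - x *: p.

Lemma coef_ode_defect x u p i :
  (ode_defect x u p)`_i = i.+1%:R * u * p`_i.+1 - (x - i%:R) * p`_i.
Proof.
rewrite /ode_defect coefB mulrDl coefD coefXM coefCM !coef_deriv coefZ.
by case: i => [|i] /=; rewrite ?mulr0n -[p`__ *+ _]mulr_natr -?[p`__ *+ i.+1]mulr_natr; ring.
Qed.

Lemma ode_defect_comp x u a p :
  ode_defect x (u + a) (p \Po ('X + a%:P)) = ode_defect x u p \Po ('X + a%:P).
Proof.
rewrite /ode_defect deriv_comp derivD derivX derivC addr0 mulr1.
rewrite comp_polyB comp_polyM comp_polyZ comp_polyD comp_polyX comp_polyC.
by rewrite -addrA -polyCD [a + u]addrC.
Qed.

(** The degree bound forces the defect of p to be 0, and then the leading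
    coefficient of p, multiplied by deg p - x, is 0 although x is not a natural
    number. *)
Lemma ode_poly_zero (I : finType) (a : I -> rat) k N x (p : {poly rat}) :
  injective a -> (forall m : nat, x != m%:R) -> (size p <= #|I| * k)%N ->
  (forall j, ('X - (a j)%:P) ^+ k %| ode_defect x N p) -> p = 0.
Proof.
move=> ainj xnat sp dvd; apply/eqP/negPn/negP => p0.
have q0 : ode_defect x N p = 0.
  apply: (hermite_unique ainj) dvd; rewrite (leq_trans _ sp) //.
  apply/leq_sizeP => i lei; rewrite coef_ode_defect !nth_default ?mulr0 ?subr0 //.
  exact: leq_trans lei _.
have := coef_ode_defect x N p (size p).-1; rewrite q0 coef0 prednK ?size_poly_gt0 //.
rewrite [p`_(size p)]nth_default // mulr0 sub0r => /esym/eqP.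
rewrite oppr_eq0 mulf_eq0 -lead_coefE lead_coef_eq0 (negPf p0) orbF subr_eq0.
by rewrite (negPf (xnat _)).
Qed.

(** The germ of v u ^ (-1/2) 4 ^ k (u + X) ^ (k + 1/2) to order k + 1. The exponent
    k + 1/2 keeps the powers of u nonnegative, so that no denominators in u
    appear, and 4 ^ k makes the coefficients integers. *)
Definition local_jet (k : nat) (u v : rat) : {poly rat} :=
  \poly_(h < k.+1) (v * 4 ^+ k * gbin (halfn k.+1) h * u ^+ (k - h)).

Lemma coef_local_jet k u v h : (h <= k)%N ->
  (local_jet k u v)`_h = v * 4 ^+ k * gbin (halfn k.+1) h * u ^+ (k - h).
Proof. by move=> lehk; rewrite coef_poly ltnS lehk. Qed.

Lemma local_jet_step k u v h : (h < k)%N ->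
  h.+1%:R * u * (local_jet k u v)`_h.+1 =
  (halfn k.+1 - h%:R) * (local_jet k u v)`_h.
Proof.
move=> lthk; rewrite (coef_local_jet _ _ lthk) (coef_local_jet _ _ (ltnW lthk)) -(subnSK lthk) exprS.
transitivity (h.+1%:R * gbin (halfn k.+1) h.+1 * (u * v * 4 ^+ k * u ^+ (k - h.+1))).
  by ring.
by rewrite gbinS_mul; ring.
Qed.

Lemma local_jet_defect k u v : 'X^k %| ode_defect (halfn k.+1) u (local_jet k u v).
Proof.
apply: dvdp_Xn_coef => h lthk.
by rewrite coef_ode_defect local_jet_step // subrr.
Qed.

Lemma local_jet_int k u v : u \is a Num.int -> v \is a Num.int ->
  local_jet k u v \is a polyOver Num.int_num_subdef.
Proof.
move=> uint vint; apply/polyOverP => h; rewrite coef_poly ltnS.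
case: leqP => [lehk|_]; last exact: rpred0.
have -> : (4 ^+ k : rat) = 4 ^+ (k - h) * 4 ^+ h by rewrite -exprD subnK.
rewrite (_ : _ * _ = v * 4 ^+ (k - h) * (4 ^+ h * gbin (halfn k.+1) h)
  * u ^+ (k - h)); last by ring.
have e1 : 4 ^+ (k - h) \is a @Num.int rat by rewrite rpredX // rpred_nat.
have e2 := gbin_half_int k.+1 h.
have e3 : u ^+ (k - h) \is a Num.int by exact: rpredX.
exact: (rpredM (rpredM (rpredM vint e1) e2) e3).
Qed.

(** The defect involves one derivative and so loses one order of contact. *)
Lemma dvdp_ode_defect_exp x u a k (p q : {poly rat}) :
  ('X - a%:P) ^+ k.+1 %| p - q -> ('X - a%:P) ^+ k %| ode_defect x u p - ode_defect x u q.
Proof.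
case/dvdpP => s E.
have -> : ode_defect x u p - ode_defect x u q = ode_defect x u (p - q).
  by rewrite /ode_defect derivB scalerBr; ring.
rewrite E /ode_defect derivM deriv_exp derivXsubC mul1r /= exprS.
set Y := 'X - _.
rewrite (_ : _ - _ = (('X + u%:P) * (s^`() * Y + s * k.+1%:R) - x%:P * s * Y)
   * Y ^+ k); first exact: dvdp_mull.
by rewrite -mul_polyC -mulr_natr; ring.
Qed.

(** An interpolant of degree less than the number of nodes times k falls under
    [ode_poly_zero], so it is 0 and all its germs are 0. *)
Lemma hermite_jet_eq0 (I : finType) (a : I -> rat) k N (v : I -> rat) :
  injective a -> (forall j, N + a j != 0) ->
  (size (hermite a k (fun j => local_jet k (N + a j) (v j))) <= #|I| * k)%N ->
  forall j, v j = 0.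
Proof.
move=> ainj u0 sp; set p := hermite _ _ _ in sp.
pose D := \prod_i denom a k i.
have D0 : D != 0.
  apply/prodf_neq0 => i _; apply/prodf_neq0 => l li; rewrite expf_neq0 //.
  by rewrite subr_eq0; apply: contra li => /eqP/ainj ->.
have cong j : ('X - (a j)%:P) ^+ k.+1 %|
    p - D *: (local_jet k (N + a j) (v j) \Po ('X - (a j)%:P)).
  exact: hermite_cong.
have p0 : p = 0.
  apply: (@ode_poly_zero I a k N (halfn k.+1) p ainj) sp _ => [m|j].
    exact: halfn_nat.
  have := dvdp_ode_defect_exp (halfn k.+1) N (cong j).
  have -> : ode_defect (halfn k.+1) N (D *: (local_jet k (N + a j) (v j) \Po ('X - (a j)%:P)))
    = D *: (ode_defect (halfn k.+1) (N + a j) (local_jet k (N + a j) (v j)) \Po ('X - (a j)%:P)).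
    rewrite -polyCN -ode_defect_comp addrK /ode_defect derivZ scalerBr.
    by congr (_ - _); [rewrite scalerAr|rewrite !scalerA mulrC].
  rewrite dvdp_subl // dvdpZr //.
  rewrite (_ : _ ^+ k = 'X^k \Po ('X - (a j)%:P)).
    by rewrite dvdp_comp_poly // local_jet_defect.
  by rewrite rmorphXn /= comp_polyX.
move=> j; have := cong j; rewrite p0 sub0r dvdpNr dvdpZr // => /dvdpP[s Es].
have := congr1 (horner^~ (a j)) Es.
rewrite horner_comp hornerM horner_exp !hornerXsubC subrr exprS mul0r mulr0.
rewrite horner_coef0 coef_local_jet // subn0 gbin0 mulr1.
have h4 : 4 ^+ k != 0 :> rat by exact: expf_neq0.
by move/eqP; rewrite !mulf_eq0 (negPf h4) (negPf (expf_neq0 _ (u0 j))) !orbF => /eqP.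
Qed.

(** * Truncated binomial series *)

Definition binp (x : rat) (M : nat) : {poly rat} := \poly_(i < M) gbin x i.

Lemma coef_binp x M i : (i < M)%N -> (binp x M)`_i = gbin x i.
Proof. by move=> ltiM; rewrite coef_poly ltiM. Qed.

Lemma binp_pascal x M y :
  (1 + y) * (binp x M.+1).[y] = (binp (x + 1) M.+1).[y] + gbin x M * y ^+ M.+1.
Proof.
have headE z : (binp z M.+1).[y] = 1 + \sum_(i < M) gbin z i.+1 * y ^+ i.+1.
  by rewrite horner_poly big_ord_recl gbin0 mulr1.
have lastE : (binp x M.+1).[y] = \sum_(i < M) gbin x i * y ^+ i + gbin x M * y ^+ M.
  by rewrite horner_poly big_ord_recr.
rewrite mulrDl mul1r {1}headE lastE headE mulrDr -!addrA; congr (_ + _).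
rewrite mulrCA -exprS addrA; congr (_ + _).
rewrite mulr_sumr -big_split /=; apply: eq_bigr => i _.
by rewrite gbin_pascal exprS; ring.
Qed.

(** Multiplying the truncated series of (1 + y) ^ (1/2) by (1 + y) ^ n changes the
    truncated series of (1 + y) ^ (n + 1/2) only beyond the truncation. The detour
    through the square root matters: near y = 0 its truncation is close to 1,
    which fixes the sign lost in [binp_sqrt], and this fails for large n. *)
Lemma binp_shift M n y : -1 <= y <= 0 ->
  `|(1 + y) ^+ n * (binp (halfn 1) M.+1).[y] - (binp (halfn n.+1) M.+1).[y]|
    <= 2 ^+ n.+1 * `|y| ^+ M.+1.
Proof.
move=> /andP[y1 y0]; pose d n := (1 + y) ^+ n * (binp (halfn 1) M.+1).[y]
  - (binp (halfn n.+1) M.+1).[y].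
have z0 : 0 <= `|y| ^+ M.+1 by exact: exprn_ge0.
suff: `|d n| <= (2 ^+ n.+1 - 1) * `|y| ^+ M.+1.
  by move/le_trans; apply; rewrite ler_wpM2r // lerBlDr lerDl.
elim: n => [|n IHn].
  by rewrite /d expr0 mul1r subrr normr0 mulr_ge0 // subr_ge0 exprn_ege1.
have -> : d n.+1 = (1 + y) * d n + gbin (halfn n.+1) M * y ^+ M.+1.
  by rewrite /d (halfnS n.+1) mulrBr binp_pascal exprS; ring.
apply: le_trans (ler_normD _ _) _.
have -> : (2 ^+ n.+2 - 1) * `|y| ^+ M.+1
   = (2 ^+ n.+1 - 1) * `|y| ^+ M.+1 + 2 ^+ n.+1 * `|y| ^+ M.+1.
  by rewrite (exprS _ n.+1); ring.
apply: lerD.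
  rewrite normrM; apply: le_trans IHn.
  rewrite -[leRHS]mul1r; apply: ler_wpM2r; first exact: normr_ge0.
  by rewrite ler_norml; apply/andP; split; lra.
by rewrite normrM normrX; apply: ler_wpM2r => //; exact: gbin_half_le.
Qed.

Lemma l1_binp M : l1 (binp (halfn 1) M) <= 2 * M%:R.
Proof.
rewrite (@l1_wide M) ?size_poly // -[X in _ <= _ * X%:R]card_ord -sum1_card.
rewrite natr_sum mulr_sumr; apply: ler_sum => i _.
by rewrite coef_binp // mulr1; apply: gbin_half_le.
Qed.

(** The square T ^ 2 of the truncated series satisfies, below the truncation
    order, the differential equation of 1 + X with the same value at 0. *)
Lemma binp_sqr_coef M i : (i < M)%N ->
  ((binp (halfn 1) M) ^+ 2 - (1 + 'X))`_i = 0.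
Proof.
case: M => // M; set T := binp _ _; set W := T ^+ 2 - _.
have defT : ode_defect (halfn 1) 1 T = (ode_defect (halfn 1) 1 T)`_M *: 'X^M.
  apply/polyP => h; rewrite coefZ coefXn.
  have [->|hM] := eqVneq h M; first by rewrite mulr1.
  rewrite mulr0 coef_ode_defect mulr1.
  have [ltMh|] := ltnP M h.
    by rewrite !nth_default ?mulr0 ?subrr //; rewrite (leq_trans (size_poly _ _)) // ltnW.
  rewrite leq_eqVlt (negPf hM) /= => lthM.
  by rewrite /T !coef_binp // 1?ltnW // gbinS_mul subrr.
set c := (ode_defect _ _ _)`_M in defT.
have defW : ode_defect 1 1 W = (2 * c) *: (T * 'X^M).
  have e : ('X + 1%:P) * T^`() = halfn 1 *: T + c *: 'X^M.
    by rewrite -defT /ode_defect [RHS]addrC subrK.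
  rewrite /ode_defect /W derivB deriv_exp derivD derivC derivX add0r mulrBr /=.
  rewrite expr1 -mulr_natr mulrA mulrA e.
  have h2 : 2 * halfn 1 = 1 by rewrite /halfn; field.
  have -> : (halfn 1 *: T + c *: 'X^M) * T * 2%:R
    = (2 * halfn 1) *: T ^+ 2 + (2 * c) *: (T * 'X^M).
    by rewrite -!mul_polyC !polyCM; move: (halfn 1)%:P => h; ring.
  by rewrite h2 !scale1r; ring.
elim: i => [|i IHi] ltiM.
  rewrite /W coefB coefD coefC coefX expr2 coefM big_ord1 subnn /T coef_binp //.
  by rewrite gbin0 mulr1 addr0 subrr.
have := congr1 (fun p : {poly rat} => p`_i) defW.
rewrite coef_ode_defect coefZ coefMXn -ltnS ltiM mulr0 IHi; last exact: ltnW.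
rewrite mulr0 subr0 mulr1 => /eqP; rewrite mulf_eq0 pnatr_eq0 /=.
by move/eqP.
Qed.

Lemma horner_vanish M (p : {poly rat}) y :
  (forall i, (i < M)%N -> p`_i = 0) -> `|y| <= 1 -> `|p.[y]| <= `|y| ^+ M * l1 p.
Proof.
move=> p0 y1; have [q E] := dvdpP _ _ (dvdp_Xn_coef p0).
by rewrite E hornerM hornerXn normrM normrX mulrC l1_mulXn ler_wpM2l ?exprn_ge0 ?horner_le_l1.
Qed.

Lemma binp_sqrt M y : `|y| <= 1 ->
  `|(binp (halfn 1) M).[y] ^+ 2 - (1 + y)| <= (4 * M%:R ^+ 2 + 2) * `|y| ^+ M.
Proof.
move=> y1; have := horner_vanish (@binp_sqr_coef M) y1.
rewrite hornerD hornerN hornerD hornerX hornerC horner_exp.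
move/le_trans; apply; rewrite mulrC; apply: ler_wpM2r; first exact: exprn_ge0.
apply: le_trans (l1D _ _) _; rewrite l1N; apply: lerD.
  apply: le_trans (l1_exp _ _) _.
  have -> : 4 * M%:R ^+ 2 = (2 * M%:R) ^+ 2 :> rat by ring.
  by rewrite lerXn2r ?nnegrE ?l1_ge0 ?mulr_ge0 // l1_binp.
by apply: le_trans (l1D _ _) _; rewrite l1C l1X normr1.
Qed.

Lemma binp_near1 M y : `|y| <= 8%:R^-1 -> 2^-1 <= (binp (halfn 1) M.+1).[y].
Proof.
move=> y8; set r := `|y| in y8 *.
have r0 : 0 <= r by exact: normr_ge0.
rewrite horner_poly big_ord_recl gbin0 mulr1 /=.
set s := \sum_(i < M) _.
have : `|s| <= \sum_(i < M) 2 * r * r ^+ i.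
  apply: le_trans (ler_norm_sum _ _ _) _; apply: ler_sum => i _.
  rewrite normrM normrX -/r /bump add1n exprS -mulrA; apply: ler_wpM2r.
    by rewrite mulr_ge0 // exprn_ge0.
  exact: gbin_half_le.
rewrite -mulr_sumr.
have : (1 - r) * \sum_(i < M) r ^+ i <= 1.
  rewrite -opprB mulNr -subrX1 opprB lerBlDr lerDl; exact: exprn_ge0.
have : 0 <= \sum_(i < M) r ^+ i by apply: sumr_ge0 => i _; exact: exprn_ge0.
set t := \sum_(i < M) _ => t0 h1 h2.
have t2 : t <= 2 by nra.
have rt : r * t <= 4^-1 by nra.
by move: h2; rewrite ler_norml => /andP[h2 _]; lra.
Qed.

(** The total constant of [binp_sqrt] and [binp_shift] for truncation at
    order 3k. *)
Definition sqrt_tail_const (k : nat) : rat :=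
  2 * (4 * (3 * k)%:R ^+ 2 + 2) + 2 ^+ k.+1.

Lemma sqrt_tail_const_ge0 k : 0 <= sqrt_tail_const k.
Proof.
have s0 : 0 <= (3 * k)%:R ^+ 2 :> rat by exact: sqr_ge0.
have p0 : 0 <= 2 ^+ k.+1 :> rat by exact: exprn_ge0.
by rewrite /sqrt_tail_const; move: (_ ^+ 2) (2 ^+ k.+1) s0 p0 => s p; lra.
Qed.

(** * Germs against Taylor polynomials *)

(** Truncated Taylor polynomial of c (1 + X / N) ^ x at 0. *)
Definition taylor_jet (x : rat) (M : nat) (N c : rat) : {poly rat} :=
  \poly_(m < M) (c * gbin x m / N ^+ m).

Lemma taylor_jet_defect x M N c : N != 0 ->
  ode_defect x N (taylor_jet x M.+1 N c)
    = (c * (M%:R - x) * gbin x M / N ^+ M) *: 'X^M.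
Proof.
move=> N0; apply/polyP => i; rewrite coef_ode_defect coefZ coefXn !coef_poly !ltnS.
case: (ltngtP i M) => [ltiM|ltMi|->]; rewrite ?mulr0 ?subrr //.
  transitivity (c / N ^+ i * (i.+1%:R * gbin x i.+1 - (x - i%:R) * gbin x i)).
    by rewrite exprS; field; rewrite N0 expf_neq0.
  by rewrite gbinS_mul subrr mulr0.
by rewrite mulr1; ring.
Qed.

Lemma horner_taylor_jet x M N c a :
  (taylor_jet x M N c).[a] = c * (binp x M).[a / N].
Proof.
rewrite !horner_poly mulr_sumr; apply: eq_bigr => i _.
by rewrite expr_div_n; ring.
Qed.

(** The coefficients of both polynomials obey the recurrence
      (h + 1) u p_(h+1) = (x - h) p_h,
    with x = k + 1/2, exactly for the germ and up to the defect for T, so the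
    differences grow at most like binom(x, h). *)
Lemma local_jet_compare k u v (T : {poly rat}) h : 1 <= u -> (h <= k)%N ->
  `|(local_jet k u v)`_h - T`_h| <= gbin (halfn k.+1) h *
    (`|(local_jet k u v)`_0 - T`_0|
      + 2 * \sum_(i < h) `|(ode_defect (halfn k.+1) u T)`_i|).
Proof.
move=> u1; elim: h => [|h IHh] lehk.
  by rewrite gbin0 mul1r big_ord0 mulr0 addr0.
have := IHh (ltnW lehk); rewrite big_ord_recr /=.
set S := `|_| + 2 * \sum_(i < h) _ => IH.
set g := local_jet k u v in IH *; set x := halfn k.+1 in IH *.
have E : h.+1%:R * u * (g`_h.+1 - T`_h.+1)
       = (x - h%:R) * (g`_h - T`_h) - (ode_defect x u T)`_h.
  have st : h.+1%:R * u * g`_h.+1 = (x - h%:R) * g`_h by exact: local_jet_step.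
  by rewrite coef_ode_defect mulrBr st; ring.
set e := (ode_defect x u T)`_h in E *.
have xh : 2^-1 <= x - h%:R.
  have : h.+1%:R <= k%:R :> rat by rewrite ler_nat.
  by rewrite /x /halfn -(natr1 h) -(natr1 k); move: (k%:R) (h%:R) => K H ?; lra.
have g1 : 1 <= gbin x h by apply: gbin_half_ge1; rewrite ltnS ltnW.
have h1 : 0 < h.+1%:R :> rat by rewrite ltr0n.
have hu : 0 < h.+1%:R * u by rewrite mulr_gt0 //; lra.
rewrite -(ler_pM2l hu) -{1}(gtr0_norm hu) -normrM E.
apply: le_trans (ler_normB _ _) _.
have -> : h.+1%:R * u * (gbin x h.+1 * (`|g`_0 - T`_0| + 2 *
    (\sum_(i < h) `|(ode_defect x u T)`_i| + `|e|)))
  = u * ((x - h%:R) * (gbin x h * S + gbin x h * (2 * `|e|))).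
  transitivity (u * (h.+1%:R * gbin x h.+1) * (S + 2 * `|e|)).
    by rewrite /S; ring.
  by rewrite gbinS_mul; ring.
have S0 : 0 <= S.
  by rewrite /S addr_ge0 // mulr_ge0 // sumr_ge0.
have xh0 : 0 <= x - h%:R by lra.
have e0 : 0 <= `|e| by exact: normr_ge0.
rewrite normrM (ger0_norm xh0).
have le1 : `|e| <= (x - h%:R) * (gbin x h * (2 * `|e|)).
  have : 2 * `|e| <= gbin x h * (2 * `|e|) by rewrite ler_peMl // mulr_ge0.
  move: (gbin x h * _) => w le2; nra.
have le2 : (x - h%:R) * `|g`_h - T`_h| <= (x - h%:R) * (gbin x h * S).
  exact: ler_wpM2l.
apply: le_trans (lerD le2 le1) _; rewrite -mulrDr ler_peMl //.
by rewrite mulr_ge0 // addr_ge0 // !mulr_ge0 //; lra.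
Qed.

Lemma l1_jet_diff k u v (T : {poly rat}) : 1 <= u ->
  l1 (take_poly k.+1 (local_jet k u v - T)) <=
    k.+1%:R * (2 ^+ k.+1 *
     (`|(local_jet k u v)`_0 - T`_0| + 2 * l1 (ode_defect (halfn k.+1) u T))).
Proof.
move=> u1; rewrite (l1_wide (size_take_poly _ _)).
rewrite -[X in _ <= X%:R * _]card_ord -sum1_card natr_sum mulr_suml.
apply: ler_sum => h _; rewrite mul1r coef_take_poly ltn_ord coefB.
apply: le_trans (local_jet_compare v T u1 _) _; first by rewrite -ltnS.
have le1 : gbin (halfn k.+1) h <= 2 ^+ k.+1.
  exact: le_trans (ler_norm _) (gbin_half_le _ _).
have g0 : 0 <= gbin (halfn k.+1) h.
  by apply: le_trans ler01 _; apply: gbin_half_ge1.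
apply: ler_pM => //; first by rewrite addr_ge0 // mulr_ge0 // sumr_ge0.
rewrite lerD2l ler_wpM2l // -[leRHS]/(l1 _).
apply: le_trans (l1_take h _); rewrite (l1_wide (size_take_poly _ _)).
by apply: ler_sum => i _; rewrite coef_take_poly ltn_ord.
Qed.

(** * Evaluating the approximation at the nodes *)

(** Comparing squares: v ^ 2 and (w z T) ^ 2 both approximate (w ^ 2 + a) z ^ 2, and
    v + w z T is at least w z / 2. *)
Lemma pell_root_approx M B w z a v d : 2 <= B -> 1 <= w -> 0 < z ->
  8%:R * B <= w ^+ 2 -> - B <= a <= 0 -> 0 <= d <= B -> 0 < v ->
  v ^+ 2 = (w ^+ 2 + a) * (z ^+ 2 - d) ->
  `|v - w * z * (binp (halfn 1) M.+1).[a / w ^+ 2]| <=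
    2 * (w * z) * ((4 * M.+1%:R ^+ 2 + 2) * `|a / w ^+ 2| ^+ M.+1)
      + 2 * B * w / z.
Proof.
move=> B2 w1 z0 w2B /andP[aB a0] /andP[d0 dB] v0 vE.
have w20 : 0 < w ^+ 2 by rewrite exprn_gt0 //; lra.
set y := a / w ^+ 2.
have ya : a = y * w ^+ 2 by rewrite divfK // gt_eqF.
have y8 : `|y| <= 8%:R^-1.
  rewrite /y normf_div (gtr0_norm w20) (ler_pdivrMr _ _ w20) (ler0_norm a0); lra.
set t := _.[y]; have t2 : 2^-1 <= t by exact: binp_near1.
have : `|t ^+ 2 - (1 + y)| <= (4 * M.+1%:R ^+ 2 + 2) * `|y| ^+ M.+1.
  by apply: binp_sqrt; apply: le_trans y8 _; lra.
set s := _ * _ ^+ M.+1 => ts.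
have wz0 : 0 < w * z by apply: mulr_gt0 => //; lra.
rewrite -(ler_pM2r wz0).
have -> : (2 * (w * z) * s + 2 * B * w / z) * (w * z)
  = 2 * ((w * z) ^+ 2 * s + w ^+ 2 * B) by field; rewrite gt_eqF.
have sum_ge : w * z <= 2 * (v + w * z * t) by nra.
have E : (v - w * z * t) * (v + w * z * t)
   = - ((w * z) ^+ 2 * (t ^+ 2 - (1 + y))) - (w ^+ 2 + a) * d.
  have -> : (v - w * z * t) * (v + w * z * t) = v ^+ 2 - (w * z * t) ^+ 2 by ring.
  by rewrite vE {1}ya [in RHS]ya; ring.
have sum0 : 0 <= v + w * z * t by lra.
have := normr_ge0 (v - w * z * t); set r := `|_| => r0.
have : r * (v + w * z * t) <= (w * z) ^+ 2 * s + w ^+ 2 * B.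
  rewrite -{1}(ger0_norm sum0) -normrM E; apply: le_trans (ler_normB _ _) _.
  rewrite normrN normrM ger0_norm ?sqr_ge0 //; apply: lerD.
    by apply: ler_wpM2l; rewrite ?sqr_ge0.
  have u0 : 0 <= w ^+ 2 + a by lra.
  rewrite ger0_norm ?mulr_ge0 //; apply: ler_pM => //; lra.
move=> h; have : r * (w * z) <= r * (2 * (v + w * z * t)) by exact: ler_wpM2l.
by move/le_trans; apply; rewrite mulrCA ler_wpM2l.
Qed.

Lemma jet_base_bound k B w z a v d : (0 < k)%N -> 2 <= B -> 1 <= w -> 0 < z ->
  8%:R * B <= w ^+ 2 -> - B <= a <= 0 -> 0 <= d <= B -> 0 < v ->
  v ^+ 2 = (w ^+ 2 + a) * (z ^+ 2 - d) ->
  `|v * 4 ^+ k * (w ^+ 2 + a) ^+ k -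
     w * z * (4 * w ^+ 2) ^+ k * (binp (halfn k.+1) (3 * k)).[a / w ^+ 2]| <=
  4 ^+ k * (2 * B) * (w ^+ k.*2.+1 / z)
   + 4 ^+ k * B ^+ (3 * k) * sqrt_tail_const k
      * (w * z / w ^+ (4 * k)).
Proof.
move=> k0 B2 w1 z0 w2B aB dB v0 vE.
have w20 : 0 < w ^+ 2 by rewrite exprn_gt0 //; lra.
have [M ME] : exists M, (3 * k = M.+1)%N by exists (3 * k).-1; rewrite prednK // muln_gt0.
have := pell_root_approx M B2 w1 z0 w2B aB dB v0 vE.
set y := a / w ^+ 2; rewrite /sqrt_tail_const ME => le1.
have [a1 a0] := andP aB.
have ya : a = w ^+ 2 * y by rewrite mulrC divfK // gt_eqF.
have wn0 : w != 0 by rewrite gt_eqF //; lra.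
have yB : `|y| <= B / w ^+ 2.
  by rewrite /y normf_div (gtr0_norm w20) ler_pM2r ?invr_gt0 // (ler0_norm a0); lra.
have y1 : -1 <= y <= 0.
  have : B / w ^+ 2 <= 1 by rewrite (ler_pdivrMr _ _ w20); lra.
  have : y <= 0 by rewrite /y pmulr_lle0 ?invr_gt0.
  by move=> h1 h2; move: yB; rewrite (ler0_norm h1) => h3; apply/andP; split; lra.
have := binp_shift M k y1.
set t1 := _.[y] in le1 *; set t2 := _.[y] => le2.
have E : v * 4 ^+ k * (w ^+ 2 + a) ^+ k - w * z * (4 * w ^+ 2) ^+ k * t2
  = (4 * w ^+ 2) ^+ k * ((v - w * z * t1) * (1 + y) ^+ k
     + w * z * ((1 + y) ^+ k * t1 - t2)).
  have -> : w ^+ 2 + a = w ^+ 2 * (1 + y) by rewrite {1}ya; ring.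
  by rewrite !exprMn; ring.
have wz0 : 0 <= w * z by apply: mulr_ge0; lra.
have W0 : 0 <= (4 * w ^+ 2) ^+ k by apply: exprn_ge0; rewrite mulr_ge0 // ltW.
rewrite E normrM (ger0_norm W0).
have yk : `|(1 + y) ^+ k| <= 1.
  rewrite normrX; apply: exprn_ile1; first exact: normr_ge0.
  by have /andP[? ?] := y1; rewrite ler_norml; apply/andP; split; lra.
have le3 : `|(v - w * z * t1) * (1 + y) ^+ k + w * z * ((1 + y) ^+ k * t1 - t2)|
  <= 2 * B * w / z + w * z * (2 * (4 * M.+1%:R ^+ 2 + 2) + 2 ^+ k.+1) * `|y| ^+ M.+1.
  apply: le_trans (ler_normD _ _) _; rewrite !normrM -!normrM (normrM (w * z)).
  rewrite (ger0_norm wz0).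
  have l1 : `|(v - w * z * t1) * (1 + y) ^+ k| <= `|v - w * z * t1|.
    by rewrite normrM ler_piMr.
  have l2 := ler_wpM2l wz0 le2.
  apply: le_trans (lerD l1 l2) _; apply: le_trans (lerD le1 (lexx _)) _.
  by rewrite le_eqVlt; apply/orP; left; apply/eqP; ring.
apply: le_trans (ler_wpM2l W0 le3) _.
rewrite mulrDr; apply: lerD.
  rewrite le_eqVlt; apply/orP; left; apply/eqP.
  by rewrite exprMn -exprM mul2n exprS; ring.
have yM : `|y| ^+ M.+1 <= B ^+ M.+1 / w ^+ (6 * k).
  have -> : B ^+ M.+1 / w ^+ (6 * k) = (B / w ^+ 2) ^+ M.+1.
    have e6 : (6 * k = 2 * M.+1)%N by rewrite -ME mulnA.
    by rewrite e6 expr_div_n exprM.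
  have Bw0 : 0 <= B / w ^+ 2 by apply: divr_ge0; [lra|exact: ltW].
  by apply: lerXn2r; rewrite ?nnegrE.
have C0 : 0 <= 2 * (4 * M.+1%:R ^+ 2 + 2) + 2 ^+ k.+1 :> rat.
  by have := sqrt_tail_const_ge0 k; rewrite /sqrt_tail_const ME.
rewrite [leLHS]mulrA; apply: le_trans (ler_wpM2l _ yM) _.
  by rewrite mulr_ge0 // mulr_ge0.
rewrite le_eqVlt; apply/orP; left; apply/eqP.
have -> : w ^+ (6 * k) = (w ^+ 2) ^+ k * w ^+ (4 * k).
  have e6 : (6 * k = 2 * k + 4 * k)%N by rewrite -mulnDl.
  by rewrite e6 exprD exprM.
rewrite exprMn; field.
by rewrite !expf_neq0.
Qed.

(** * The simultaneous approximation inequality *)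

(** The difference at the node is [jet_base_bound]; the defect of the Taylor
    polynomial is one monomial of degree 3k - 1 in z, whose coefficient carries
    the factor N ^ (1 - 2k), where N = w ^ 2. *)
Lemma jet_error_bound k B w z a v d : (0 < k)%N -> 2 <= B -> 1 <= w -> 0 < z ->
  8%:R * B <= w ^+ 2 -> - B <= a <= 0 -> 0 <= d <= B -> 0 < v ->
  v ^+ 2 = (w ^+ 2 + a) * (z ^+ 2 - d) ->
  l1 (take_poly k.+1 (local_jet k (w ^+ 2 + a) v -
     (taylor_jet (halfn k.+1) (3 * k) (w ^+ 2) (w * z * (4 * w ^+ 2) ^+ k)
        \Po ('X + a%:P)))) <=
  k.+1%:R * (2 ^+ k.+1 * (4 ^+ k * (2 * B) * (w ^+ k.*2.+1 / z)
   + (4 ^+ k * B ^+ (3 * k) * sqrt_tail_const k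
       + 2 * (4 ^+ k * (3 * k)%:R * 2 ^+ k.+1 * (1 + B) ^+ (3 * k)))
      * (w ^+ 3 * z / w ^+ (4 * k)))).
Proof.
move=> k0 B2 w1 z0 w2B aB dB v0 vE.
have w20 : 0 < w ^+ 2 by rewrite exprn_gt0 //; lra.
have w0 : 0 < w by lra.
have wn0 : w != 0 by rewrite gt_eqF.
have [a1 a0] := andP aB.
have u1 : 1 <= w ^+ 2 + a by lra.
apply: le_trans (l1_jet_diff _ _ _ u1) _.
rewrite ler_wpM2l // ler_wpM2l ?exprn_ge0 //.
have base := jet_base_bound k0 B2 w1 z0 w2B aB dB v0 vE.
rewrite coef_local_jet // gbin0 mulr1 subn0.
have -> : (taylor_jet (halfn k.+1) (3 * k) (w ^+ 2) (w * z * (4 * w ^+ 2) ^+ k)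
        \Po ('X + a%:P))`_0 =
   w * z * (4 * w ^+ 2) ^+ k * (binp (halfn k.+1) (3 * k)).[a / w ^+ 2].
  by rewrite -horner_coef0 horner_comp hornerD hornerX hornerC add0r horner_taylor_jet.
have Q0 : 0 <= w * z / w ^+ (4 * k) by rewrite divr_ge0 ?exprn_ge0 ?mulr_ge0 // ltW.
have Q1 : w * z / w ^+ (4 * k) <= w ^+ 3 * z / w ^+ (4 * k).
  rewrite ler_pM2r ?invr_gt0 ?exprn_gt0 // ler_pM2r //.
  by rewrite -[leLHS]expr1; apply: ler_weXn2l.
set P := w ^+ _ / z in base *.
set X2 := 4 ^+ k * B ^+ (3 * k) * _ in base *.
have X20 : 0 <= X2.
  have B0 : 0 <= B by clear -B2; lra.
  exact: mulr_ge0 (mulr_ge0 (exprn_ge0 k _) (exprn_ge0 _ B0)) (sqrt_tail_const_ge0 k).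
rewrite [X in _ <= _ + X]mulrDl addrA; apply: lerD.
  by apply: le_trans base _; rewrite lerD2l ler_wpM2l.
rewrite -[leRHS]mulrA ler_wpM2l //.
have [M ME] : exists M, (3 * k = M.+1)%N by exists (3 * k).-1; rewrite prednK // muln_gt0.
rewrite ode_defect_comp ME taylor_jet_defect ?gt_eqF // comp_polyZ l1Z.
have cM : `|M%:R - halfn k.+1| <= M.+1%:R.
  rewrite /halfn -(natr1 k) -(natr1 M).
  have : k%:R <= M%:R :> rat by rewrite ler_nat -ltnS -ME -{1}(mul1n k) ltn_pmul2r.
  have : 0 <= k%:R :> rat by exact: ler0n.
  move: (k%:R) (M%:R) => K L K0 KL; rewrite ler_norml; apply/andP; split; lra.
have gM := gbin_half_le k.+1 M.
have lX : l1 ('X ^+ M \Po ('X + a%:P)) <= (1 + B) ^+ M.+1.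
  rewrite rmorphXn /= comp_polyX; apply: le_trans (l1_exp _ _) _.
  apply: (@le_trans _ _ ((1 + B) ^+ M)); last by apply: ler_weXn2l => //; lra.
  apply: lerXn2r; rewrite ?nnegrE ?l1_ge0 //; first by lra.
  by apply: le_trans (l1_XaddC _) _; rewrite lerD2l (ler0_norm a0); lra.
have -> : w * z * (4 * w ^+ 2) ^+ k * (M%:R - halfn k.+1) * gbin (halfn k.+1) M / (w ^+ 2) ^+ M
  = 4 ^+ k * (w ^+ 3 * z / w ^+ (4 * k)) * ((M%:R - halfn k.+1) * gbin (halfn k.+1) M).
  have e1 : (w ^+ 2) ^+ M * w ^+ 2 = (w ^+ 2) ^+ k * w ^+ (4 * k).
    by rewrite -exprSr -ME -!exprM -exprD !mulnA -mulnDl.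
  have -> : (w ^+ 2) ^+ M = (w ^+ 2) ^+ k * w ^+ (4 * k) / w ^+ 2.
    by rewrite -e1 mulfK // gt_eqF.
  rewrite exprMn; move: (M%:R - _) (gbin _ _) => c g.
  by field; rewrite wn0 !expf_neq0.
have Q3 : 0 <= w ^+ 3 * z / w ^+ (4 * k) := le_trans Q0 Q1.
set Q := w ^+ 3 * z / _ in Q3 *.
rewrite normrM (ger0_norm (mulr_ge0 (exprn_ge0 k _) Q3)) // normrM.
have le1 : `|M%:R - halfn k.+1| * `|gbin (halfn k.+1) M| <= M.+1%:R * 2 ^+ k.+1.
  by apply: ler_pM => //; exact: normr_ge0.
have -> : 4 ^+ k * M.+1%:R * 2 ^+ k.+1 * (1 + B) ^+ M.+1 * Q
  = 4 ^+ k * Q * (M.+1%:R * 2 ^+ k.+1) * (1 + B) ^+ M.+1 by ring.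
have C0 : 0 <= 4 ^+ k * Q by rewrite mulr_ge0 // exprn_ge0.
have N0 : 0 <= `|M%:R - halfn k.+1| * `|gbin (halfn k.+1) M| by exact: mulr_ge0.
exact: (ler_pM (mulr_ge0 C0 N0) (l1_ge0 _) (ler_wpM2l C0 le1) lX).
Qed.

(** All constants are absorbed into a single power of B + 2; the argument is
    bookkeeping of exponents with crude estimates such as k + 1 <= 2 ^ k. *)
Lemma pade_constant_bound k (B P Q : rat) : (0 < k)%N -> 2 <= B -> 0 <= P -> 0 <= Q ->
  3%:R * ((B + 2) ^+ (2 * (2 * (k.+1 + k) + (k.+1 + (k.+1 + k))) + k) *
  (k.+1%:R * (2 ^+ k.+1 * (4 ^+ k * (2 * B) * P
   + (4 ^+ k * B ^+ (3 * k) * sqrt_tail_const k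
       + 2 * (4 ^+ k * (3 * k)%:R * 2 ^+ k.+1 * (1 + B) ^+ (3 * k)))
      * Q)))) <= (B + 2) ^+ (38 * k) * (P + Q).
Proof.
move=> k0 B2 P0 Q0; set A := B + 2.
have A4 : 4 <= A by rewrite /A; lra.
have A1 : 1 <= A by lra.
have A0 e : 0 <= A ^+ e by apply: exprn_ge0; clear -A4; lra.
have Ak e f : (e <= f)%N -> A ^+ e <= A ^+ f by exact: ler_weXn2l.
have kA : k.+1%:R <= A ^+ k.
  apply: (@le_trans _ _ (2 ^+ k)); last by apply: lerXn2r; rewrite ?nnegrE //; lra.
  by rewrite -natrX ler_nat; exact: ltn_expl.
have twoA e : 2 ^+ e <= A ^+ e by apply: lerXn2r; rewrite ?nnegrE //; lra.
have fourA e : 4 ^+ e <= A ^+ e by apply: lerXn2r; rewrite ?nnegrE //; lra.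
have BA e : B ^+ e <= A ^+ e by apply: lerXn2r; rewrite ?nnegrE /A //; lra.
have BA1 e : (1 + B) ^+ e <= A ^+ e by apply: lerXn2r; rewrite ?nnegrE /A //; lra.
have kk : k%:R <= A ^+ k by apply: le_trans kA; rewrite ler_nat.
have le_mulA (x y : rat) e f : 0 <= x -> 0 <= y -> x <= A ^+ e -> y <= A ^+ f ->
    x * y <= A ^+ (e + f) by move=> x0 y0 xe yf; rewrite exprD; apply: ler_pM.
have X1 : 4 ^+ k * (2 * B) <= A ^+ (k + 2).
  apply: (le_mulA) => //; rewrite ?exprn_ge0 //; first by lra.
  by rewrite expr2 /A; nra.
have c3k : (3 * k)%:R <= A ^+ (1 + k).
  by rewrite natrM; apply: (le_mulA) => //; rewrite expr1; lra.
have X2' : sqrt_tail_const k <= A ^+ (k.*2 + 4).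
  have h : 2 ^+ k.+1 <= 2 * A ^+ k.*2.
    by rewrite exprS ler_wpM2l // (le_trans (twoA k)) // Ak // -addnn leq_addr.
  have h2 : (3 * k)%:R ^+ 2 <= 9%:R * A ^+ k.*2.
    rewrite natrM exprMn -natrX ler_wpM2l // -muln2 exprM.
    by apply: lerXn2r; rewrite ?nnegrE.
  have h3 : 1 <= A ^+ k.*2 by apply: exprn_ege1.
  have h4 : 256%:R <= A ^+ 4.
    by have -> : 256%:R = 4 ^+ 4 :> rat by []; exact: fourA.
  rewrite /sqrt_tail_const exprD; move: (A ^+ k.*2) (A ^+ 4) ((3 * k)%:R ^+ 2) (2 ^+ k.+1) h h2 h3 h4.
  by move=> p q r s *; nra.
have X2 : 4 ^+ k * B ^+ (3 * k) * sqrt_tail_const k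
     <= A ^+ (k + 3 * k + (k.*2 + 4)).
  have B0 : 0 <= B by clear -B2; lra.
  have p0 : 0 <= 4 ^+ k * B ^+ (3 * k) by rewrite mulr_ge0 ?exprn_ge0.
  apply: (le_mulA) => //; first exact: sqrt_tail_const_ge0.
  by apply: (le_mulA); rewrite ?exprn_ge0 //; lra.
have X3 : 4 ^+ k * (3 * k)%:R * 2 ^+ k.+1 * (1 + B) ^+ (3 * k)
     <= A ^+ (k + (1 + k) + k.+1 + 3 * k).
  apply: (le_mulA) => //; first by rewrite !mulr_ge0 ?exprn_ge0.
    by apply: exprn_ge0; clear -B2; lra.
  apply: (le_mulA) => //; rewrite ?mulr_ge0 ?exprn_ge0 //.
  by apply: (le_mulA); rewrite ?exprn_ge0.
set x1 := 4 ^+ k * (2 * B) in X1 *.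
set x2 := 4 ^+ k * B ^+ _ * _ in X2 *.
set x3 := _ * (1 + B) ^+ _ in X3 *.
have S : x1 * P + (x2 + 2 * x3) * Q <= A ^+ (6 * k + 5) * (P + Q).
  have a1 : x1 <= A ^+ (6 * k + 5) by apply: le_trans X1 _; apply: Ak; move: k0; clear; lia.
  have a2 : x2 <= A ^+ (6 * k + 4) by apply: le_trans X2 _; apply: Ak; move: k0; clear; lia.
  have a3 : x3 <= A ^+ (6 * k + 4) by apply: le_trans X3 _; apply: Ak; move: k0; clear; lia.
  rewrite mulrDr; apply: lerD; apply: ler_wpM2r => //.
  have -> : A ^+ (6 * k + 5) = A * A ^+ (6 * k + 4) by rewrite -exprS -addnS.
  by have := A0 (6 * k + 4)%N; nra.
have PQ : 0 <= P + Q by rewrite addr_ge0.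
set e := (2 * _ + k)%N.
have S2 : 3%:R * (A ^+ e * (k.+1%:R * 2 ^+ k.+1)) <= A ^+ (1 + (e + (k + k.+1))).
  have le3 : 3%:R <= A ^+ 1 by rewrite expr1; lra.
  have p1 : 0 <= k.+1%:R * 2 ^+ k.+1 :> rat by rewrite mulr_ge0 ?exprn_ge0.
  apply: (le_mulA) => //; first by rewrite mulr_ge0.
  by apply: (le_mulA) => //; apply: (le_mulA); rewrite ?exprn_ge0.
have -> : 3%:R * (A ^+ e * (k.+1%:R * (2 ^+ k.+1 * (x1 * P + (x2 + 2 * x3) * Q))))
   = 3%:R * (A ^+ e * (k.+1%:R * 2 ^+ k.+1)) * (x1 * P + (x2 + 2 * x3) * Q) by ring.
have p0 : 0 <= 3%:R * (A ^+ e * (k.+1%:R * 2 ^+ k.+1)).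
  by rewrite mulr_ge0 // mulr_ge0 // mulr_ge0 ?exprn_ge0.
apply: le_trans (ler_wpM2l p0 S) _; rewrite [leLHS]mulrA; apply: ler_wpM2r => //.
apply: le_trans (ler_wpM2r (A0 _) S2) _; rewrite -exprD; apply: Ak.
by rewrite /e; move: k0; clear; lia.
Qed.

(** The leading coefficient of the interpolant of the germs [local_jet] is a
    nonzero integer in degree at least 3k, by [hermite_jet_eq0]. It is also
    the coefficient of the interpolant of the differences with the Taylor
    polynomial, which is small. *)
Lemma pade_inequality k B w z (a v d : 'I_3 -> rat) :
  (0 < k)%N -> 2 <= B -> 1 <= w -> 0 < z -> 8%:R * B <= w ^+ 2 ->
  w \is a Num.int -> (forall j, a j \is a Num.int) ->
  (forall j, v j \is a Num.int) -> injective a ->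
  (forall j, - B <= a j <= 0) -> (forall j, 0 <= d j <= B) ->
  (forall j, 0 < v j) ->
  (forall j, v j ^+ 2 = (w ^+ 2 + a j) * (z ^+ 2 - d j)) ->
  1 <= (B + 2) ^+ (38 * k)
    * (w ^+ k.*2.+1 / z + w ^+ 3 * z / w ^+ (4 * k)).
Proof.
move=> k0 B2 w1 z0 w2B wint aint vint ainj aB dB v0 vE.
have w0 : 0 < w by lra.
pose G j := local_jet k (w ^+ 2 + a j) (v j).
pose T := taylor_jet (halfn k.+1) (3 * k) (w ^+ 2) (w * z * (4 * w ^+ 2) ^+ k).
pose R j := T \Po ('X + (a j)%:P).
pose p := hermite a k G.
have u0 j : w ^+ 2 + a j != 0.
  by have /andP[? ?] := aB j; rewrite gt_eqF //; lra.
have ltp : (3 * k < size p)%N.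
  rewrite ltnNge; apply/negP; rewrite -{1}(card_ord 3) => sp.
  by have := v0 ord0; rewrite (hermite_jet_eq0 ainj u0 sp ord0) ltxx.
pose i := (size p).-1.
have le_i : (3 * k <= i)%N by rewrite -ltnS prednK // (leq_ltn_trans _ ltp).
have pint : p`_i \is a Num.int.
  have pp : p \is a polyOver Num.int_num_subdef.
    apply: hermite_int => // j; apply: local_jet_int => //.
    by apply: rpredD => //; exact: rpredX.
  by move/polyOverP: pp; apply.
have p1 : 1 <= `|p`_i|.
  apply: norm_intr_ge1 => //.
  by rewrite -lead_coefE lead_coef_eq0 -size_poly_gt0 (leq_ltn_trans _ ltp).
have sT : (size T <= 3 * k)%N by exact: size_poly.
have hR : hermite a k R = (\prod_j denom a k j) *: T.
  apply: hermite_id => //; rewrite card_ord; apply: leq_trans sT _.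
  by rewrite leq_mul2l leqnSn.
have pi : p`_i = (hermite a k (fun j => take_poly k.+1 (G j - R j)))`_i.
  rewrite -(hermite_take a k (fun j => G j - R j)) -hermiteB hR coefB coefZ.
  by rewrite [T`_i]nth_default ?mulr0 ?subr0 // (leq_trans sT).
have B1 : 1 <= B by lra.
have aB' j : `|a j| <= B.
  by have /andP[? ?] := aB j; rewrite ler_norml; apply/andP; split; lra.
have daB i1 j : `|a i1 - a j| <= B.
  have /andP[? ?] := aB j; have /andP[? ?] := aB i1.
  by rewrite ler_norml; apply/andP; split; lra.
apply: le_trans p1 _; rewrite pi; apply: le_trans (coef_le_l1 _ _) _.
have bound := fun j => jet_error_bound k0 B2 w1 z0 w2B (aB j) (dB j) (v0 j) (vE j).
have le1 := @l1_hermite _ a k 2 B _ (fun j => take_poly k.+1 (G j - R j))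
  (card_ord 3) B1 aB' daB bound.
apply: le_trans le1 _.
apply: pade_constant_bound => //.
  by rewrite divr_ge0 ?exprn_ge0 // ltW.
by rewrite divr_ge0 ?mulr_ge0 ?exprn_ge0 // ltW.
Qed.

(** * The gap between two solutions *)

(** Here k = m + 6 and Z lies between w ^ (3k) and w ^ (3k + 3), so both summands are
    at most w ^ (-m), while k <= 2m turns A ^ (38k) into at most A ^ (76m). *)
Lemma pade_gap_contra (A w Z : rat) m : (6 <= m)%N -> 4 <= A -> A ^+ 77 <= w ->
  w ^+ (3 * (m + 6)) <= Z -> Z <= w ^+ (3 * (m + 6) + 3) ->
  A ^+ (38 * (m + 6)) *
    (w ^+ (m + 6).*2.+1 / Z + w ^+ 3 * Z / w ^+ (4 * (m + 6))) < 1.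
Proof.
move=> m6 A4 Aw le1 le2.
have A1 : 1 <= A by lra.
have w1 : 1 <= w by apply: le_trans Aw; apply: exprn_ege1.
have w0 e : 0 < w ^+ e by apply: exprn_gt0; lra.
have Z0 : 0 < Z by apply: lt_le_trans le1.
have t1 : w ^+ (m + 6).*2.+1 / Z <= (w ^+ m)^-1.
  rewrite (ler_pdivrMr _ _ Z0) mulrC (ler_pdivlMr _ _ (w0 m)) -exprD.
  by apply: le_trans le1; apply: ler_weXn2l => //; move: m6; clear; lia.
have t2 : w ^+ 3 * Z / w ^+ (4 * (m + 6)) <= (w ^+ m)^-1.
  rewrite (ler_pdivrMr _ _ (w0 _)) [leRHS]mulrC.
  have -> : (4 * (m + 6) = 3 + (3 * (m + 6) + 3) + m)%N by clear; lia.
  by rewrite exprD mulfK ?gt_eqF // exprD; apply: ler_wpM2l le2; exact: ltW.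
apply: (@le_lt_trans _ _ (A ^+ (38 * (m + 6)) * (2 * (w ^+ m)^-1))).
  by apply: ler_wpM2l; [apply: exprn_ge0; lra|rewrite mulr_natl mulr2n lerD].
rewrite mulrA (ltr_pdivrMr _ _ (w0 m)) mul1r.
have le3 : A ^+ (76 * m) * A ^+ m <= w ^+ m.
  rewrite -exprD -mulSnr exprM; apply: lerXn2r; rewrite ?nnegrE //.
    by apply: exprn_ge0; lra.
  by lra.
apply: lt_le_trans le3.
have le4 : A ^+ (38 * (m + 6)) <= A ^+ (76 * m).
  by apply: ler_weXn2l => //; move: m6; clear; lia.
have le5 : 2 < A ^+ m.
  apply: (@lt_le_trans _ _ (A ^+ 1)); first by rewrite expr1; lra.
  by apply: ler_weXn2l => //; move: m6; clear; lia.
have p : 0 < A ^+ (76 * m) by apply: exprn_gt0; lra.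
by apply: le_lt_trans (ler_wpM2r _ le4) _ => //; rewrite ltr_pM2l.
Qed.

(** The exponent k of [pade_inequality] is chosen as the integer part of
    log z' / log (z ^ 3); if z' >= z ^ 36, it is at least 12. *)
Lemma pell_gap (a b x y z x' y' z' : int) : 2 <= b -> 0 < a ->
  pell_solution a b x y z -> pell_solution a b x' y' z' ->
  (b + 3) ^+ 77 <= z -> z' < z ^+ 36.
Proof.
move=> b2 a0 [[x0 y0 z0] [E1 E2]] [[x'0 y'0 z'0] [E1' E2']] zbig.
rewrite ltNge; apply/negP => z36.
have z1 : 1 < z.
  by apply: lt_le_trans zbig; apply: exprn_egt1 => //; lia.
pose n := `|z|%N; pose n' := `|z'|%N.
have nE : z = n%:Z by rewrite /n gez0_abs // ltW.
have n'E : z' = n'%:Z by rewrite /n' gez0_abs // ltW.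
have n1 : (1 < n)%N by rewrite -ltz_nat -nE.
have n31 : (1 < n ^ 3)%N by rewrite -{1}(exp1n 3) ltn_exp2r.
have n'0 : (0 < n')%N by rewrite -ltz_nat -n'E.
pose k := trunc_log (n ^ 3) n'.
have /andP[kle klt] := trunc_log_bounds n31 n'0.
rewrite -/k -!expnM in kle klt.
have k12 : (12 <= k)%N.
  have : (n ^ 36 < n ^ (3 * k.+1))%N.
    apply: leq_ltn_trans klt.
    by rewrite -lez_nat -n'E -[Posz (n ^ 36)]natz natrX natz -nE.
  by rewrite ltn_exp2l //; clear; lia.
have [m kE] : exists m, k = (m + 6)%N by exists (k - 6)%N; rewrite subnK // (leq_trans _ k12).
pose w : rat := z%:~R; pose Z : rat := z'%:~R; pose B : rat := (b + 1)%:~R.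
have wE : w = n%:R by rewrite /w nE.
have ZE : Z = n'%:R by rewrite /Z n'E.
have B2 : 2 <= B by rewrite (_ : 2 = (2 : int)%:~R) // ler_int; clear -b2; lia.
have Aw : (B + 2) ^+ 77 <= w.
  have -> : B + 2 = (b + 3)%:~R by rewrite /B !intrD -addrA.
  by rewrite -rmorphXn /= ler_int.
have w1 : 1 <= w by rewrite (_ : 1 = (1 : int)%:~R) // ler_int ltW.
have Z0 : 0 < Z by rewrite ltr0z.
have w2B : 8%:R * B <= w ^+ 2.
  have A1 : 1 <= B + 2 by lra.
  have : (B + 2) ^+ 4 <= w by apply: le_trans Aw; apply: ler_weXn2l.
  have : 8%:R * B <= (B + 2) ^+ 4.
    have : 4 <= (B + 2) ^+ 2 by rewrite expr2; nra.
    by rewrite -[4%N]/(2 * 2)%N exprM; move: ((B + 2) ^+ 2) (expr2 (B + 2)) => s sE; nra.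
  by move=> h1 h2; apply: (le_trans (le_trans h1 h2)); rewrite expr2; nra.
(* the nodes, the integers v_j, and v_j ^ 2 = (z ^ 2 + a_j) (z' ^ 2 - d_j) *)
pose av : 'I_3 -> rat := fun j => (nth 0 [:: 0; -1; - (b + 1)] j)%:~R.
pose vv : 'I_3 -> rat :=
  fun j => (nth 0 [:: z * z'; b * x * x'; a * b * y * y'] j)%:~R.
pose dv : 'I_3 -> rat := fun j => (nth 0 [:: 0; 1; b + 1] j)%:~R.
have B2' : 2 < B + 2 by lra.
suff : 1 <= (B + 2) ^+ (38 * k) * (w ^+ k.*2.+1 / Z + w ^+ 3 * Z / w ^+ (4 * k)).
  rewrite kE leNgt pade_gap_contra //; first by move: k12; rewrite kE; clear; lia.
  - by lra.
  - by rewrite -kE wE ZE -natrX ler_nat.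
  by rewrite -kE wE ZE -natrX ler_nat ltnW // -mulnSr.
apply: (@pade_inequality k B w Z av vv dv) => //; rewrite ?intr_int //.
- exact: leq_trans k12.
- by move=> j; exact: intr_int.
- by move=> j; exact: intr_int.
- move=> i j /eqP; rewrite eqr_int => e; apply/val_inj; move: e; clear -b2.
  by case: i => [[|[|[|//]]] ?]; case: j => [[|[|[|//]]] ?] //=; lia.
- move=> j; rewrite /av /B -mulrNz ler_int lerz0; clear -b2.
  by case: j => [[|[|[|//]]] ?] /=; lia.
- move=> j; rewrite /dv /B ler_int ler0z; clear -b2.
  by case: j => [[|[|[|//]]] ?] /=; lia.
- move=> j; rewrite /vv ltr0z; clear -b2 a0 x0 y0 z0 x'0 y'0 z'0.
  by case: j => [[|[|[|//]]] ?] /=; rewrite ?mulr_gt0 //; lia.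
move=> j; rewrite /vv /w /Z /av /dv -!rmorphXn /= -intrD -intrB -intrM; congr (_%:~R).
have e1 : z ^+ 2 = 1 + b * x ^+ 2 by rewrite -E2; ring.
have e2 : z' ^+ 2 = 1 + b * x' ^+ 2 by rewrite -E2'; ring.
have e3 : x ^+ 2 = 1 + a * y ^+ 2 by rewrite -E1; ring.
have e4 : x' ^+ 2 = 1 + a * y' ^+ 2 by rewrite -E1'; ring.
case: j => [[|[|[|//]]] ?] /=; rewrite ?exprMn ?e1 ?e2 ?e3 ?e4; ring.
Qed.

(** * Powers of a common Pell unit *)

Section RealQuadratic.

Variable R : rcfType.

Definition surd (s : R) (x y : int) : R := x%:~R + y%:~R * s.

Lemma surdM (a : int) s x y x' y' : s ^+ 2 = a%:~R ->
  surd s (x * x' + a * y * y') (x * y' + y * x') = surd s x y * surd s x' y'.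
Proof.
move=> sE; rewrite /surd !(intrD, intrM) -sE; ring.
Qed.

(** A product of powers and its conjugate are U + V s and U - V s for the same
    integers, so their sum is the integer 2U. *)
Lemma surd_conj_prod (b : int) s p q z x z' x' : s ^+ 2 = b%:~R ->
  exists U V, surd s z x ^+ p * surd s z' x' ^+ q = surd s U V
           /\ surd s z (- x) ^+ p * surd s z' (- x') ^+ q = surd s U (- V).
Proof.
move=> sE.
have stepP U V c d : exists U' V', surd s c d * surd s U V = surd s U' V'
    /\ surd s c (- d) * surd s U (- V) = surd s U' (- V').
  exists (c * U + b * d * V), (c * V + d * U).
  rewrite -!(surdM _ _ _ _ sE); split=> //; congr surd; ring.
elim: p => [|p [U [V [e e']]]].
  elim: q => [|q [U [V [e e']]]].
    by exists 1, 0; rewrite /surd !mulr0z !mul0r !addr0 !mulr1.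
  have [U' [V' [f f']]] := stepP U V z' x'.
  by exists U', V'; rewrite -f -f' -e -e' !expr0 !mul1r !exprS.
have [U' [V' [f f']]] := stepP U V z x.
by exists U', V'; rewrite -f -f' -e -e' !exprS !mulrA.
Qed.

(** The Euclidean algorithm in the exponents: the quotient of the larger solution
    by the smaller one is again a positive solution, and its y is smaller. *)
Lemma pell_common_root (a : int) s : 0 < a -> s ^+ 2 = a%:~R ->
  forall x1 y1 x2 y2 : int, 0 < x1 -> 0 < y1 -> 0 < x2 -> 0 < y2 ->
  x1 ^+ 2 - a * y1 ^+ 2 = 1 -> x2 ^+ 2 - a * y2 ^+ 2 = 1 ->
  exists x y m1 m2, [/\ 0 < x, 0 < y, (0 < m1)%N & (0 < m2)%N] /\
    [/\ surd s x1 y1 = surd s x y ^+ m1 & surd s x2 y2 = surd s x y ^+ m2].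
Proof.
move=> a0 sE x1 y1 x2 y2.
have [n] := ubnP (`|y1| + `|y2|)%N.
elim: n x1 y1 x2 y2 => // n IHn x1 y1 x2 y2 le_n x10 y10 x20 y20 E1 E2.
wlog lex : x1 y1 x2 y2 le_n x10 y10 x20 y20 E1 E2 / x1 <= x2.
  move=> wl; case: (leP x1 x2) => [|/ltW] le; first exact: wl.
  have := wl x2 y2 x1 y1; rewrite addnC => /(_ le_n x20 y20 x10 y10 E2 E1 le).
  by case=> x [y [m1 [m2 [[p1 p2 p3 p4] [q1 q2]]]]]; exists x, y, m2, m1.
have [xE|xne] := eqVneq x1 x2.
  have yE : y1 = y2.
    have : a * (y1 ^+ 2) = a * y2 ^+ 2 by move: E1 E2; rewrite xE; lia.
    move/(mulfI (lt0r_neq0 a0))/eqP; rewrite eqf_sqr => /orP[/eqP //|/eqP e].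
    by move: y10; rewrite e oppr_gt0 ltNge ltW.
  by exists x1, y1, 1%N, 1%N; rewrite xE yE.
have ltx : x1 < x2 by rewrite lt_neqAle xne.
(* the quotient (x2 + y2 s) / (x1 + y1 s) *)
pose x3 := x1 * x2 - a * y1 * y2; pose y3 := x1 * y2 - x2 * y1.
have E3 : x3 ^+ 2 - a * y3 ^+ 2 = 1.
  have -> : x3 ^+ 2 - a * y3 ^+ 2
    = (x1 ^+ 2 - a * y1 ^+ 2) * (x2 ^+ 2 - a * y2 ^+ 2) by rewrite /x3 /y3; ring.
  by rewrite E1 E2.
have y12 : y1 < y2.
  rewrite -(ltr_pXn2r (ltn0Sn 1)) ?nnegrE ?ltW // -(ltr_pM2l a0).
  have : x1 ^+ 2 < x2 ^+ 2 by rewrite ltr_pXn2r ?nnegrE ?ltW.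
  by move: E1 E2; lia.
have x30 : 0 < x3.
  rewrite /x3 subr_gt0 -(ltr_pXn2r (ltn0Sn 1)) ?nnegrE ?mulr_ge0 ?ltW //.
  have -> : (a * y1 * y2) ^+ 2 = (a * y1 ^+ 2) * (a * y2 ^+ 2) by ring.
  have -> : a * y1 ^+ 2 = x1 ^+ 2 - 1 by rewrite -E1; ring.
  have -> : a * y2 ^+ 2 = x2 ^+ 2 - 1 by rewrite -E2; ring.
  have : 0 < x1 ^+ 2 by rewrite exprn_gt0.
  have : 0 < x2 ^+ 2 by rewrite exprn_gt0.
  by rewrite exprMn; move: (x1 ^+ 2) (x2 ^+ 2) => X Y; nia.
have y30 : 0 < y3.
  rewrite /y3 subr_gt0 -(ltr_pXn2r (ltn0Sn 1)) ?nnegrE ?mulr_ge0 ?ltW //.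
  rewrite !exprMn.
  have -> : x1 ^+ 2 = 1 + a * y1 ^+ 2 by rewrite -E1; ring.
  have -> : x2 ^+ 2 = 1 + a * y2 ^+ 2 by rewrite -E2; ring.
  have : y1 ^+ 2 < y2 ^+ 2 by rewrite ltr_pXn2r ?nnegrE ?ltW.
  by move: (y1 ^+ 2) (y2 ^+ 2) => X Y; nia.
have y2E : y2 = x1 * y3 + y1 * x3.
  transitivity (y2 * (x1 ^+ 2 - a * y1 ^+ 2)); first by rewrite E1 mulr1.
  by rewrite /x3 /y3; ring.
have x2E : x2 = x1 * x3 + a * y1 * y3.
  transitivity (x2 * (x1 ^+ 2 - a * y1 ^+ 2)); first by rewrite E1 mulr1.
  by rewrite /x3 /y3; ring.
have y32 : y3 < y2 by rewrite y2E; clear -x10 y10 x30 y30; nia.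
have le_n3 : (`|y1| + `|y3| < n)%N.
  by clear -le_n y10 y20 y30 y32; lia.
have [x [y [m1 [m3 [[p1 p2 p3 p4] [q1 q3]]]]]] := IHn _ _ _ _ le_n3 x10 y10 x30 y30 E1 E3.
exists x, y, m1, (m1 + m3)%N; split; first by split=> //; rewrite addn_gt0 p3.
split=> //; rewrite exprD -q1 -q3 -(surdM _ _ _ _ sE).
by rewrite x2E y2E.
Qed.

(** The product of the two differences is the integer
    1 + b ^ M (b ^ M - t), which is congruent to 1 modulo b and thus nonzero. *)
Lemma unit_vs_power (b : int) (X Y : R) (t : int) M : 2 <= b -> (0 < M)%N ->
  X * Y = 1 -> X + Y = t%:~R ->
  1 <= `|X - b%:~R ^+ M| * `|Y - b%:~R ^+ M|.
Proof.
move=> b2 M0 XY Xt; rewrite -normrM.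
have -> : (X - b%:~R ^+ M) * (Y - b%:~R ^+ M) = (1 + b ^+ M * (b ^+ M - t))%:~R.
  rewrite intrD intrM intrB rmorphXn /= -Xt.
  transitivity (X * Y + b%:~R ^+ M * (b%:~R ^+ M - (X + Y))); first by ring.
  by rewrite XY.
rewrite -intr_norm ler1z -gtz0_ge1 normr_gt0; apply/negP => /eqP e.
have : (b %| 1)%Z.
  apply/dvdzP; exists (- (b ^+ M.-1 * (b ^+ M - t))).
  rewrite -(prednK M0) exprS /= in e *.
  rewrite mulNr; apply/eqP; rewrite -subr_eq0 opprK; apply/eqP.
  by rewrite -[RHS]e; ring.
by rewrite dvdz1; clear -b2; lia.
Qed.

Lemma pow_1Dx_le (t : R) n : 0 <= t -> n%:R * t <= 2^-1 ->
  (1 + t) ^+ n <= 1 + 2 * n%:R * t.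
Proof.
move=> t0; elim: n => [|n IHn] nt; first by rewrite mulr0 mul0r addr0.
have nt' : n%:R * t <= 2^-1.
  by apply: le_trans nt; apply: ler_wpM2r => //; rewrite ler_nat.
have n0 : 0 <= n%:R :> R by exact: ler0n.
rewrite exprS; apply: le_trans (ler_wpM2l _ (IHn nt')) _; first by lra.
have h : t * (n%:R * t) <= t * 2^-1 by exact: ler_wpM2l.
by rewrite -(natr1 n); move: (n%:R) h => N h; lra.
Qed.

(** The difference z - s y r is (1 + b) / (z + s y r), since
    z ^ 2 - b (x ^ 2 - 1) = 1 + b. *)
Lemma pell_ratio_bound (a b s r x y z : R) :
  1 <= b -> 0 < s -> s ^+ 2 = b -> 0 < r -> r ^+ 2 = a -> 0 < x -> 0 < y -> 0 < z ->
  x ^+ 2 - a * y ^+ 2 = 1 -> z ^+ 2 - b * x ^+ 2 = 1 ->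
  1 <= (z + x * s) / (s * (x + y * r)) <= 1 + 2 / x ^+ 2.
Proof.
move=> b1 s0 sE r0 rE x0 y0 z0 E1 E2.
have yr0 : 0 < y * r by exact: mulr_gt0.
have sx0 : 0 < s * x by exact: mulr_gt0.
have al0 : 0 < s * (x + y * r) by rewrite mulr_gt0 // addr_gt0.
have yrE : (y * r) ^+ 2 = x ^+ 2 - 1 by rewrite exprMn rE -E1; ring.
have syr0 : 0 < s * (y * r) by exact: mulr_gt0.
have diff : (z - s * (y * r)) * (z + s * (y * r)) = 1 + b.
  transitivity (z ^+ 2 - s ^+ 2 * (y * r) ^+ 2); first by ring.
  by rewrite sE yrE -[in z ^+ 2](subrK (b * x ^+ 2) (z ^+ 2)) E2; ring.
have x20 : 0 < x ^+ 2 by rewrite exprn_gt0.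
have zE : z ^+ 2 = 1 + b * x ^+ 2 by rewrite -E2; ring.
have zsx : s * x <= z.
  rewrite -(ler_pXn2r (ltn0Sn 1)) ?nnegrE ?ltW // exprMn sE zE; lra.
have d0 : 0 < z - s * (y * r).
  have zs : 0 < z + s * (y * r) by rewrite addr_gt0.
  by rewrite -(pmulr_lgt0 _ zs) diff; lra.
have dle : (z - s * (y * r)) * (s * x) <= 1 + b.
  rewrite -diff ler_pM2l //; lra.
apply/andP; split.
  by rewrite (ler_pdivlMr _ _ al0) mul1r mulrDr; lra.
rewrite (ler_pdivrMr _ _ al0).
have -> : z + x * s = s * (x + y * r) + (z - s * (y * r)) by ring.
rewrite mulrDl mul1r lerD2l mulrAC (ler_pdivlMr _ _ x20).
rewrite -(ler_pM2r sx0).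
have h1 : (z - s * (y * r)) * x ^+ 2 * (s * x) <= (1 + b) * x ^+ 2.
  by rewrite mulrAC ler_pM2r.
apply: le_trans h1 _.
have -> : 2 * (s * (x + y * r)) * (s * x) = 2 * b * (x ^+ 2 + (y * r) * x).
  by rewrite -sE; ring.
have p : 0 <= y * r * x by rewrite ltW // mulr_gt0.
have q : 0 <= b * (y * r * x) by rewrite mulr_ge0 //; lra.
have q' : x ^+ 2 <= b * x ^+ 2 by rewrite ler_peMl // ltW.
lra.
Qed.

(** X is within c eta of c, and its inverse Y, being at most 2, is within c of
    c. *)
Lemma reciprocal_power_gap (c E F eta X Y : R) :
  2 <= c -> 0 <= eta -> c * c * eta < 1 -> 1 <= E <= 1 + eta ->
  1 <= F <= 1 + eta -> X * F = c * E -> X * Y = 1 ->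
  `|X - c| * `|Y - c| < 1.
Proof.
move=> c2 eta0 eta_small /andP[E1 E2] /andP[F1 F2] XF XY.
have eta1 : eta < 1 by clear -c2 eta0 eta_small; nra.
have c0 : 0 < c by clear -c2; lra.
have E0 : 0 < E by clear -E1; lra.
have F0 : 0 < F by clear -F1; lra.
have cE0 : 0 < c * E by exact: mulr_gt0.
have YE : Y * (c * E) = F by rewrite -XF mulrA [Y * X]mulrC XY mul1r.
have Y0 : 0 < Y by rewrite -(pmulr_lgt0 _ cE0) YE.
have Yle : Y <= 2.
  have cE1 : 1 <= c * E by clear -c2 E1; nra.
  have : Y * 1 <= Y * (c * E) by rewrite ler_pM2l.
  by rewrite YE; clear -F2 eta1; lra.
have hY : `|Y - c| <= c.
  by rewrite ler_norml; apply/andP; split; clear -Y0 Yle c2; lra.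
have hX : `|X - c| <= c * eta.
  have h : (X - c) * F = c * (E - F) by rewrite mulrBl XF; ring.
  have h2 : `|X - c| * F = c * `|E - F|.
    by rewrite -{1}(gtr0_norm F0) -normrM h normrM gtr0_norm.
  have h3 : `|E - F| <= eta.
    by rewrite ler_norml; apply/andP; split; clear -E1 E2 F1 F2; lra.
  have : `|X - c| * 1 <= `|X - c| * F by rewrite ler_wpM2l.
  rewrite mulr1 h2 => /le_trans; apply; apply: ler_wpM2l h3; exact: ltW.
apply: le_lt_trans eta_small.
have -> : c * c * eta = c * eta * c by ring.
by apply: ler_pM.
Qed.

(** Since (al ^ m1) ^ m2 = (al ^ m2) ^ m1, the quotient
    (z1 + x1 s) ^ (2 m2) / (z2 + x2 s) ^ (2 m1) is b ^ (m2 - m1) times powers of the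
    ratios in [pell_ratio_bound]. If x1 were large these powers would be so close
    to 1 that [unit_vs_power] fails for the quotient and its conjugate. *)
Lemma pell_power_separation (a b : int) (r s al : R) x1 y1 z1 x2 y2 z2 m1 m2 :
  2 <= b -> 0 < r -> r ^+ 2 = a%:~R -> 0 < s -> s ^+ 2 = b%:~R -> 0 < al ->
  pell_solution a b x1 y1 z1 -> pell_solution a b x2 y2 z2 -> x1 <= x2 ->
  (m1 < m2)%N -> surd r x1 y1 = al ^+ m1 -> surd r x2 y2 = al ^+ m2 ->
  x1%:~R ^+ 2 <= b%:~R ^+ (m2 - m1).*2 * (8 * m2)%:R :> R.
Proof.
move=> b2 r0 rE s0 sE al0 [[x10 y10 z10] [P1 Q1]] [[x20 y20 z20] [P2 Q2]] x12 m12 e1 e2.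
rewrite leNgt; apply/negP => small.
have b1 : 1 <= b%:~R :> R by rewrite ler1z; clear -b2; lia.
have castE (u v w : int) : u ^+ 2 - v * w ^+ 2 = 1 ->
    u%:~R ^+ 2 - v%:~R * w%:~R ^+ 2 = 1 :> R.
  by move/(congr1 (fun n : int => n%:~R : R)); rewrite intrB intrM !rmorphXn.
have pos (n : int) : 0 < n -> 0 < n%:~R :> R by rewrite ltr0z.
pose g1 := surd s z1 x1; pose g2 := surd s z2 x2.
pose rho1 := g1 / (s * surd r x1 y1); pose rho2 := g2 / (s * surd r x2 y2).
have B1 : 1 <= rho1 <= 1 + 2 / x1%:~R ^+ 2.
  exact: (pell_ratio_bound b1 s0 sE r0 rE (pos _ x10) (pos _ y10) (pos _ z10)
    (castE _ _ _ P1) (castE _ _ _ Q1)).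
have B2 : 1 <= rho2 <= 1 + 2 / x2%:~R ^+ 2.
  exact: (pell_ratio_bound b1 s0 sE r0 rE (pos _ x20) (pos _ y20) (pos _ z20)
    (castE _ _ _ P2) (castE _ _ _ Q2)).
have X10 : 0 < x1%:~R ^+ 2 :> R by rewrite exprn_gt0 ?pos.
pose t : R := 2 / x1%:~R ^+ 2.
have t0 : 0 <= t by exact: divr_ge0 (ler0n _ 2) (ltW X10).
have B2' : rho2 <= 1 + t.
  have /andP[_ le] := B2; apply: le_trans le _; rewrite lerD2l ler_pM2l //.
  rewrite lef_pV2 ?posrE ?exprn_gt0 ?pos //.
  by apply: lerXn2r; rewrite ?nnegrE ?ler0z ?ler_int // ltW.
set M := (m2 - m1)%N in small.
pose Bm : R := b%:~R ^+ M.
have M0 : (0 < M)%N by rewrite subn_gt0.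
have Bm1 : 1 <= Bm by exact: exprn_ege1.
have Bm2 : 2 <= Bm.
  apply: (@le_trans _ _ (b%:~R ^+ 1)); last exact: ler_weXn2l.
  by rewrite expr1 (_ : 2 = (2 : int)%:~R) // ler_int.
have smallE : b%:~R ^+ M.*2 = Bm * Bm :> R by rewrite -exprD addnn.
rewrite smallE in small.
pose eta : R := (8 * m2)%:R / x1%:~R ^+ 2.
have eta0 : 0 <= eta by exact: divr_ge0 (ler0n _ _) (ltW X10).
have eta_small : Bm * Bm * eta < 1.
  by rewrite /eta mulrA (ltr_pdivrMr _ _ X10) mul1r.
have eta1 : eta < 1 by clear -Bm2 eta0 eta_small; nra.
have etaE : 2 * (m2.*2)%:R * t = eta.
  rewrite /t /eta -muln2 !natrM; ring.
have powle : (1 + t) ^+ m2.*2 <= 1 + eta.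
  rewrite -etaE; apply: pow_1Dx_le => //.
  by move: eta1; rewrite -etaE; lra.
have [r1a r1b] := andP B1; have [r2a r2b] := andP B2.
pose E := rho1 ^+ m2.*2; pose F := rho2 ^+ m1.*2.
have E1 : 1 <= E by exact: exprn_ege1.
have F1 : 1 <= F by exact: exprn_ege1.
have E2 : E <= 1 + eta.
  have rho10 : 0 <= rho1 by clear -r1a; lra.
  have t10 : 0 <= 1 + t by clear -t0; lra.
  by apply: le_trans powle; apply: lerXn2r.
have F2 : F <= 1 + eta.
  apply: le_trans powle; apply: (@le_trans _ _ ((1 + t) ^+ m1.*2)).
    have rho20 : 0 <= rho2 by clear -r2a; lra.
    have t10 : 0 <= 1 + t by clear -t0; lra.
    by apply: lerXn2r.
  by apply: ler_weXn2l; [clear -t0; lra|rewrite leq_double ltnW].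
have [U [V [eX eY]]] := surd_conj_prod m2.*2 m1.*2 z1 x1 z2 (- x2) sE.
rewrite opprK in eY.
set X := surd s U V in eX; set Y := surd s U (- V) in eY.
have unitE (z x : int) : z ^+ 2 - b * x ^+ 2 = 1 -> surd s z x * surd s z (- x) = 1.
  move=> /castE <-; rewrite /surd mulrNz -sE; ring.
have U1 := unitE _ _ Q1; have U2 := unitE _ _ Q2.
have XY : X * Y = 1.
  rewrite -eX -eY mulrACA -!exprMn U1 [surd s z2 (- x2) * _]mulrC U2.
  by rewrite !expr1n mulr1.
have XYt : X + Y = (2 * U)%:~R.
  by rewrite /X /Y /surd mulrNz intrM; ring.
have al1 : 0 < surd r x1 y1 by rewrite e1 exprn_gt0.
have al2 : 0 < surd r x2 y2 by rewrite e2 exprn_gt0.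
have g1E : g1 = rho1 * (s * surd r x1 y1) by rewrite divfK // mulf_neq0 ?gt_eqF.
have g2E : g2 = rho2 * (s * surd r x2 y2) by rewrite divfK // mulf_neq0 ?gt_eqF.
have XF : X * F = Bm * E.
  pose T := al ^+ (m1 * m2).*2.
  have T0 : 0 < T by rewrite exprn_gt0.
  have h : X * g2 ^+ m1.*2 = g1 ^+ m2.*2.
    by rewrite -eX -mulrA -exprMn [surd s z2 (- x2) * _]mulrC U2 expr1n mulr1.
  have c0 : b%:~R ^+ m1 * T != 0 :> R.
    by rewrite mulf_neq0 ?gt_eqF // exprn_gt0 //; lra.
  have G2 : g2 ^+ m1.*2 = F * (b%:~R ^+ m1 * T).
    rewrite g2E (exprMn _ rho2) -/F (exprMn _ s) e2 -(exprM al) -doubleMr.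
    by rewrite -(mul2n m1) (exprM s) sE [(m2 * m1)%N]mulnC.
  have G1 : g1 ^+ m2.*2 = E * (b%:~R ^+ m2 * T).
    rewrite g1E (exprMn _ rho1) -/E (exprMn _ s) e1 -(exprM al) -doubleMr.
    by rewrite -(mul2n m2) (exprM s) sE.
  have BmE : b%:~R ^+ m2 = Bm * b%:~R ^+ m1 :> R.
    by rewrite /Bm -exprD subnK // ltnW.
  apply: (mulIf c0); move: h; rewrite G1 G2 BmE !mulrA => ->.
  by congr (_ * _ * _); rewrite [RHS]mulrC.
have := unit_vs_power b2 M0 XY XYt; rewrite -/Bm leNgt => /negP; apply.
by apply: (reciprocal_power_gap Bm2 eta0 eta_small _ _ XF XY); apply/andP.
Qed.

End RealQuadratic.

(** * Uniqueness *)

(** Exponents: a >= (b + 3) ^ 200 gives z1 >= (b + 3) ^ 100, so [pell_gap] applies and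
    yields m2 <= 37 m1; then [pell_power_separation] bounds x1 ^ 2 by
    (b + 3) ^ (73 m1 + 4), against 4 x1 ^ 2 >= (b + 3) ^ (200 m1). *)
Lemma pell_unique_lt (b : nat) (a x1 y1 z1 x2 y2 z2 : int) : (2 <= b)%N ->
  ((b + 3) ^ 200)%N%:Z <= a ->
  pell_solution a b%:Z x1 y1 z1 -> pell_solution a b%:Z x2 y2 z2 ->
  ~ x1 < x2.
Proof.
move=> b2 abig S1 S2 x12.
have [[x10 y10 z10] [P1 Q1]] := S1; have [[x20 y20 z20] [P2 Q2]] := S2.
pose A : int := b%:Z + 3.
have aA : A ^+ 200 <= a.
  apply: le_trans abig.
  by rewrite -[Posz ((b + 3) ^ 200)]natz natrX natz PoszD.
clear abig.
have A5 : 5 <= A by rewrite /A; clear -b2; lia.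
have A1 : 1 <= A by apply: le_trans A5.
have a0 : 0 < a by apply: lt_le_trans aA; apply: exprn_gt0; apply: lt_le_trans A5.
have b2z : 2 <= b%:Z by clear -b2; lia.
(* z1 is already large because z1 ^ 2 > x1 ^ 2 >= a *)
have x1a : a <= x1 ^+ 2.
  have -> : x1 ^+ 2 = 1 + a * y1 ^+ 2 by rewrite -P1; ring.
  have y11 : 1 <= y1 ^+ 2 by rewrite exprn_ege1.
  by clear -y11 a0; nia.
have zbx : z1 ^+ 2 = 1 + b%:Z * x1 ^+ 2 by rewrite -Q1; ring.
have z1big : A ^+ 100 <= z1.
  have A0 : 0 <= A by apply: le_trans A1.
  rewrite -(ler_pXn2r (ltn0Sn 1)) ?nnegrE ?exprn_ge0 ?(ltW z10) //.
  have -> : A ^+ 100 ^+ 2 = A ^+ 200 by rewrite -exprM.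
  apply: le_trans aA _; rewrite zbx.
  by clear -x1a a0 b2z; nia.
have gap : z2 < z1 ^+ 36.
  apply: (pell_gap b2z a0 S1 S2); apply: le_trans z1big.
  by apply: ler_weXn2l.
clear z1big.
(* pass to a real closed field containing the square roots of a and b *)
pose R : rcfType := realalg.
pose r : R := Num.sqrt a%:~R; pose s : R := Num.sqrt b%:Z%:~R.
have r0 : 0 < r by rewrite sqrtr_gt0 ltr0z.
have rE : r ^+ 2 = a%:~R by rewrite sqr_sqrtr // ler0z ltW.
have bz0 : 0 < b%:Z by apply: lt_le_trans b2z.
have s0 : 0 < s by rewrite sqrtr_gt0 ltr0z.
have sE : s ^+ 2 = b%:Z%:~R by rewrite sqr_sqrtr // ler0z ltW.
have [x [y [m1 [m2 [[x0 y0 m10 m20] [e1 e2]]]]]] :=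
  pell_common_root a0 rE x10 y10 x20 y20 P1 P2.
set al := surd r x y in e1 e2.
have rA : A%:~R ^+ 100 <= r.
  have A0 : 0 <= A%:~R :> R by rewrite ler0z (le_trans _ A1).
  rewrite -(ler_pXn2r (ltn0Sn 1)) ?nnegrE ?exprn_ge0 ?(ltW r0) //.
  have -> : A%:~R ^+ 100 ^+ 2 = (A ^+ 200)%:~R :> R by rewrite -exprM rmorphXn.
  by rewrite rE ler_int.
have alr : r <= al.
  have hy : 1 * r <= y%:~R * r by rewrite ler_pM2r // ler1z.
  have hx : 0 < x%:~R :> R by rewrite ltr0z.
  by rewrite /al /surd; clear -hx hy; lra.
have AR1 : 1 <= A%:~R :> R by rewrite ler1z.
have AR5 : 5%:R <= A%:~R :> R.
  by rewrite (_ : 5%:R = (5 : int)%:~R) // ler_int.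
have alA := le_trans rA alr.
have al1 : 1 < al.
  apply: lt_le_trans alA; apply: (@lt_le_trans _ _ (A%:~R ^+ 1)).
    by rewrite expr1; apply: lt_le_trans AR5; rewrite ltr1n.
  exact: ler_weXn2l.
have al0 : 0 < al by exact: lt_trans al1.
have surd_ge (X Y : int) : 0 < X -> 0 < Y -> X%:~R <= surd r X Y.
  by move=> X0 Y0; rewrite /surd lerDl mulr_ge0 ?ler0z //; exact: ltW.
have surd_le (X Y : int) : 0 < X -> 0 < Y -> X ^+ 2 - a * Y ^+ 2 = 1 ->
    surd r X Y <= 2 * X%:~R.
  move=> X0 Y0 E; rewrite /surd mulr_natl mulr2n lerD2l.
  have X0' : 0 <= X%:~R :> R by rewrite ler0z ltW.
  have Yr0 : 0 <= Y%:~R * r by rewrite mulr_ge0 ?ler0z // ltW.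
  rewrite -(ler_pXn2r (ltn0Sn 1)) ?nnegrE //.
  rewrite exprMn rE -!rmorphXn -rmorphM /= ler_int mulrC.
  have -> : a * Y ^+ 2 = X ^+ 2 - 1 by rewrite -E; ring.
  by rewrite lerBlDr lerDl.
have m12 : (m1 < m2)%N.
  rewrite -(ltr_eXn2l al1) -e1 -e2 /surd.
  have y12 : y1 < y2.
    rewrite -(ltr_pXn2r (ltn0Sn 1)) ?nnegrE ?ltW // -(ltr_pM2l a0).
    have : x1 ^+ 2 < x2 ^+ 2 by rewrite ltr_pXn2r ?nnegrE ?ltW.
    by clear -P1 P2; lia.
  by apply: ltrD; rewrite ?ltr_pM2r // ltr_int.
have sep := pell_power_separation b2z r0 rE s0 sE al0 S1 S2 (ltW x12) m12 e1 e2.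
(* al ^ m2 <= 2 x2 < 2 z1 ^ 36, and z1 <= (b + 3) al ^ m1 *)
have X10 : 0 < x1%:~R :> R by rewrite ltr0z.
have x1le : x1%:~R <= al ^+ m1 by rewrite -e1; exact: surd_ge.
have x1ge : al ^+ m1 <= 2 * x1%:~R by rewrite -e1; exact: surd_le.
have m2le : (m2 <= 37 * m1)%N.
  rewrite leqNgt; apply/negP => big.
  have z1x : z1%:~R <= A%:~R * al ^+ m1.
    apply: (@le_trans _ _ (A * x1)%:~R); last first.
      by rewrite intrM; apply: ler_wpM2l x1le; apply: le_trans AR1.
    have Ax0 : 0 <= A * x1 by rewrite mulr_ge0 ?(le_trans _ A1) ?(ltW x10).
    rewrite ler_int -(ler_pXn2r (ltn0Sn 1)) ?nnegrE ?(ltW z10) //.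
    rewrite exprMn zbx /A; have x11 : 1 <= x1 ^+ 2 by rewrite exprn_ege1.
    by clear -x11 b2z; nia.
  have x2z2 : x2%:~R <= z2%:~R :> R.
    rewrite ler_int -(ler_pXn2r (ltn0Sn 1)) ?nnegrE ?(ltW x20) ?(ltW z20) //.
    have -> : z2 ^+ 2 = 1 + b%:Z * x2 ^+ 2 by rewrite -Q2; ring.
    by have := sqr_ge0 x2; clear -b2z; nia.
  have le1 : al ^+ m2 < 2 * (A%:~R * al ^+ m1) ^+ 36.
    rewrite -e2; apply: le_lt_trans (surd_le _ _ x20 y20 P2) _.
    rewrite ltr_pM2l //; apply: le_lt_trans x2z2 _.
    apply: (@lt_le_trans _ _ (z1 ^+ 36)%:~R); first by rewrite ltr_int.
    rewrite rmorphXn; apply: lerXn2r z1x; rewrite nnegrE; first by rewrite ler0z ltW.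
    by apply: mulr_ge0; [exact: le_trans AR1|apply: exprn_ge0; exact: ltW].
  have le2 : 2 * A%:~R ^+ 36 <= al.
    apply: le_trans alA; apply: (@le_trans _ _ (A%:~R ^+ 37)); last exact: ler_weXn2l.
    rewrite (exprS _ 36); apply: ler_wpM2r; first by rewrite exprn_ge0 ?(le_trans _ AR1).
    by apply: le_trans AR5; rewrite ler_nat.
  have le3 : al ^+ m2 < al ^+ (36 * m1).+1.
    have -> : al ^+ (36 * m1).+1 = al * al ^+ m1 ^+ 36.
      by rewrite -exprM -[(m1 * 36)%N]mulnC -exprS.
    apply: lt_le_trans le1 _; rewrite exprMn mulrA.
    by apply: ler_wpM2r le2; rewrite !exprn_ge0 // ltW.
  by move: le3; rewrite (ltr_eXn2l al1); move: big m10; clear; lia.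
(* a ^ m1 <= 4 x1 ^ 2 is incompatible with the separation bound *)
have le1 : A%:~R ^+ (200 * m1) <= 4 * x1%:~R ^+ 2 :> R.
  have -> : 4 * x1%:~R ^+ 2 = (2 * x1%:~R) ^+ 2 :> R by ring.
  have -> : (200 * m1 = 100 * m1 * 2)%N by clear; lia.
  rewrite exprM; apply: lerXn2r; rewrite ?nnegrE ?mulr_ge0 ?(ltW X10) //.
    by apply: exprn_ge0; apply: le_trans AR1.
  apply: le_trans x1ge; rewrite exprM; apply: lerXn2r => //; rewrite nnegrE ?ltW //.
  by rewrite exprn_gt0 // (lt_le_trans _ AR1).
have bA : b%:Z%:~R ^+ (m2 - m1).*2 <= A%:~R ^+ (72 * m1) :> R.
  apply: (@le_trans _ _ (A%:~R ^+ (m2 - m1).*2)).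
    have bA : b%:Z%:~R <= A%:~R :> R by rewrite ler_int /A lerDl.
    by apply: lerXn2r bA; rewrite nnegrE ler0z //; apply: le_trans A1.
  by apply: ler_weXn2l => //; move: m2le; clear; lia.
have m2A : (8 * m2)%:R <= A%:~R ^+ (4 + m1) :> R.
  apply: (@le_trans _ _ (5 ^ (4 + m1))%N%:R).
    rewrite ler_nat; apply: (@leq_trans (8 * (37 * m1))); first by rewrite leq_mul2l m2le.
    rewrite expnD; have := ltn_expl m1 (isT : (1 < 5)%N).
    by move: (5 ^ m1)%N => p; clear; lia.
  by rewrite natrX; apply: lerXn2r; rewrite ?nnegrE // (le_trans _ AR1).
have AA0 e : 0 <= A%:~R ^+ e :> R by apply: exprn_ge0; apply: le_trans AR1.
have := le_trans sep (ler_pM _ _ bA m2A); rewrite -exprD => /(_ _ _) le2.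
have le3 : 4 * x1%:~R ^+ 2 <= A%:~R ^+ (1 + (72 * m1 + (4 + m1))) :> R.
  rewrite (exprD _ 1) expr1; apply: ler_pM => //; rewrite ?sqr_ge0 //.
    by apply: le_trans AR5; rewrite ler_nat.
  by apply: le2 => //; apply: exprn_ge0; rewrite ler0z ltW.
have := le_trans le1 le3; apply/negP; rewrite -ltNge.
have AR1' : 1 < A%:~R :> R by rewrite ltr1z; apply: lt_le_trans A5.
by rewrite (ltr_eXn2l AR1'); move: m10; clear; lia.
Qed.

Theorem theorem1p2 :
  exists a0 : nat -> nat, computable a0 /\
    forall b : nat, (2 <= b)%N ->
    forall a : int, b%:Z < a -> (a0 b)%:Z <= a ->
    forall x y z x' y' z' : int,
      pell_solution a b%:Z x y z -> pell_solution a b%:Z x' y' z' ->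
      (x, y, z) = (x', y', z').
Proof.
exists (fun b => (b + 3) ^ 200)%N; split.
  have [c cP] := computable_exp 200
    (computable_succ (computable_succ (computable_succ computable_id))).
  by exists c => n; rewrite addn3; apply: cP.
move=> b b2 a ba abig x y z x' y' z' S S'.
have xE : x = x'.
  have [lt|lt|//] := ltgtP x x'.
    by case: (pell_unique_lt b2 abig S S').
  by case: (pell_unique_lt b2 abig S' S).
case: S S' => [[x0 y0 z0] [P Q]] [[x'0 y'0 z'0] [P' Q']].
have a0 : a != 0 by rewrite gt_eqF // (le_lt_trans _ ba).
have sqr_inj (u v : int) : 0 < u -> 0 < v -> u ^+ 2 = v ^+ 2 -> u = v.
  move=> u0 v0 /eqP; rewrite eqf_sqr => /orP[/eqP //|/eqP e].
  by move: u0; rewrite e oppr_gt0 ltNge ltW.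
have -> : y = y'.
  apply: sqr_inj => //; apply: (mulfI a0).
  by apply: oppr_inj; apply: (addrI (x ^+ 2)); rewrite P xE.
have -> : z = z'.
  by apply: sqr_inj => //; apply: (addIr (- (b%:Z * x ^+ 2))); rewrite Q xE.
by rewrite xE.
Qed.
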